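(* Let $n\ge 2$ and let $\gamma=[1][2,3,\dots,n]\in D_n$. The interval $[I,\gamma]=\{\alpha\in D_n:\alpha\le\gamma\}$ in $D_n$ is a lattice with respect to the partial order $\le$.
   Context: $C_n$ is the group of all $\alpha\in O(n)$ with $\alpha([-1,1]^n)=[-1,1]^n$. It acts on $\{\pm e_1,\dots,\pm e_n\}$ and is thereby identified with the group of permutations $\alpha$ of $\{1,\dots,n,-1,\dots,-n\}$ satisfying $\alpha(-i)=-\alpha(i)$. $D_n$ is the index two subgroup of $C_n$ generated by the set $\mathcal R_d$ of reflections in the hyperplanes $x_i=x_j$ and $x_i=-x_j$, $i\neq j$. The set of reflections in $D_n$ is $\mathcal R_d$. The balanced cycle $[i_1,\dots,i_k]$ denotes the $2k$-cycle $(i_1,\dots,i_k,-i_1,\dots,-i_k)$. $I$ is the identity. The reflection length $l(w)$ of $w\in D_n$ is the least $k$ such that $w$ is a product of $k$ elements of $\mathcal R_d$, and $u\le w$ means $l(w)=l(u)+l(u^{-1}w)$; this is a partial order on $D_n$. *)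

(* Defs.v *)
From mathcomp Require Import all_boot all_fingroup.

Set Implicit Arguments.
Unset Strict Implicit.
Unset Printing Implicit Defensive.

Local Open Scope group_scope.

(* [R ^+ k] is the set of products of [k] elements of [R]. *)

Lemma ex_expgs (gT : finGroupType) (R : {set gT}) (w : gT) :
  exists k, (w \in <<R>>) ==> (w \in R ^+ k).
Proof.
case: (boolP (w \in <<R>>)) => [/gen_prodgP [k [c Rc ->]]|_]; last by exists 0%N.
exists k; rewrite implyTb.
elim: k c Rc => [|k IHk] c Rc; first by rewrite big_ord0 set11.
by rewrite big_ord_recl expgS mem_mulg ?Rc // IHk.
Qed.

(* The least [k] with [w \in R ^+ k]; by convention 0 if [w \notin <<R>>]. *)
Definition abs_length (gT : finGroupType) (R : {set gT}) (w : gT) : nat :=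
  ex_minn (ex_expgs R w).

Lemma abs_lengthP (gT : finGroupType) (R : {set gT}) (w : gT) :
  w \in <<R>> ->
  w \in R ^+ abs_length R w /\ forall k, w \in R ^+ k -> abs_length R w <= k.
Proof.
move=> Rw; rewrite /abs_length; case: ex_minnP => m; rewrite Rw /= => wm min_m.
by split=> // k wk; apply: min_m.
Qed.

Definition is_poset (T : finType) (A : {set T}) (le : rel T) : Prop :=
  [/\ {in A, reflexive le},
      {in A &, antisymmetric le}
    & {in A & &, transitive le}].

Definition is_meet (T : finType) (A : {set T}) (le : rel T) (x y m : T) : Prop :=
  [/\ m \in A, le m x, le m y
    & forall z, z \in A -> le z x -> le z y -> le z m].

Definition is_join (T : finType) (A : {set T}) (le : rel T) (x y j : T) : Prop :=
  [/\ j \in A, le x j, le y j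
    & forall z, z \in A -> le x z -> le y z -> le j z].

Definition is_lattice (T : finType) (A : {set T}) (le : rel T) : Prop :=
  is_poset A le /\
  forall x y, x \in A -> y \in A ->
    (exists m, is_meet A le x y m) /\ (exists j, is_join A le x y j).

(* The set {1, ..., n, -1, ..., -n}, i.e. {e_1, ..., e_n, -e_1, ..., -e_n}:
   [(i, false)] stands for i + 1 and [(i, true)] for -(i + 1). *)
Notation spoint n := ('I_n * bool)%type.

Definition sneg (n : nat) (p : spoint n) : spoint n := (p.1, ~~ p.2).

Definition Cn (n : nat) : {set {perm spoint n}} :=
  [set a : {perm spoint n} | [forall p, a (sneg p) == sneg (a p)]].

(* The reflection in the hyperplane orthogonal to e_p - e_q, where
   e_{-i} = - e_i.  For p = i it is x_i = x_j if q = j and x_i = -x_j if q = -j. *)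
Definition sreflection (n : nat) (p q : spoint n) : {perm spoint n} :=
  tperm p q * tperm (sneg p) (sneg q).

Definition Rd (n : nat) : {set {perm spoint n}} :=
  [set a | [exists p : spoint n, exists q : spoint n,
              (p.1 != q.1) && (a == sreflection p q)]].

Definition Dn (n : nat) : {group {perm spoint n}} := <<Rd n>>%G.

Lemma Dn_sub_Cn (n : nat) : Dn n \subset Cn n.
Proof.
have Cn_group: group_set (Cn n).
  apply/group_setP; split=> [|a b].
    by rewrite inE; apply/forallP=> p; rewrite !perm1.
  rewrite !inE => /forallP Ca /forallP Cb; apply/forallP=> p.
  by rewrite !permM (eqP (Ca p)) (eqP (Cb _)).
rewrite -[Cn n]/(gval (Group Cn_group)) gen_subG.
have snegK: involutive (@sneg n) by case=> i x; rewrite /sneg /= negbK.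
apply/subsetP=> a; rewrite !inE.
case/existsP=> p /existsP[q /andP[pq /eqP->]]; apply/forallP=> r.
have tN (x y z : spoint n) : sneg (tperm x y z) = tperm (sneg x) (sneg y) (sneg z).
  exact: inj_tperm (inv_inj snegK).
have tC : commute (tperm p q) (tperm (sneg p) (sneg q)).
  apply/commgP/conjg_fixP; rewrite tpermJ !tpermD //.
  - by apply: contraNneq pq => <-.
  - by apply/eqP=> /(congr1 snd) /=; case: (q.2).
  - by apply/eqP=> /(congr1 snd) /=; case: (p.2).
  - by apply: contraNneq pq => <-.
by rewrite /sreflection [X in _ == sneg X]permM !tN !snegK -permM -tC.
Qed.

Definition dlength (n : nat) (w : {perm spoint n}) : nat :=
  abs_length (Rd n) w.

(* In MathComp, [u * v] is "first [u], then [v]".  As [Rd n] is stable under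
   conjugation, [u^-1 * w] and [w * u^-1] have the same length, so this order
   does not depend on the composition convention. *)
Definition dle (n : nat) (u w : {perm spoint n}) : bool :=
  dlength w == (dlength u + dlength (u^-1 * w))%N.

Definition dinterval (n : nat) (w : {perm spoint n}) : {set {perm spoint n}} :=
  [set u in Dn n | dle u w].

(* The sequence i_1, ..., i_k, -i_1, ..., -i_k. *)
Definition balanced (n : nat) (s : seq (spoint n)) : seq (spoint n) :=
  s ++ [seq sneg p | p <- s].

(* The balanced cycle [i_1, ..., i_k]; the identity if [balanced s] has
   repetitions that prevent [next] from being a permutation. *)
Definition bcycle (n : nat) (s : seq (spoint n)) : {perm spoint n} :=
  insubd (1 : {perm spoint n}) [ffun p => next (balanced s) p].

Lemma bcycleE (n : nat) (s : seq (spoint n)) :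
  uniq (balanced s) -> bcycle s =1 next (balanced s).
Proof.
move=> Us p; rewrite -pvalE /bcycle /insubd.
case: insubP => [u _ -> | /negP[]]; first by rewrite ffunE.
by apply/injectiveP => x y; rewrite !ffunE => /(can_inj (prev_next Us)).
Qed.

(* The sequence a, a + 1, ..., b inside {1, ..., n}. *)
Definition srange (n a b : nat) : seq (spoint n) :=
  [seq (i, false) | i : 'I_n <- enum 'I_n & a <= i.+1 <= b].

Lemma uniq_balanced_srange (n a b : nat) : uniq (balanced (srange n a b)).
Proof.
have Us: uniq (srange n a b).
  by rewrite map_inj_uniq => [|i j []] //; rewrite filter_uniq ?enum_uniq.
rewrite cat_uniq Us map_inj_uniq ?Us ?andbT /=; last first.
  by case=> [i x] [j y] [-> /negb_inj->].
apply/hasPn=> _ /mapP[_ /mapP[i _ ->] ->].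
by apply/negP=> /mapP[].
Qed.

(* [1][2, 3, ..., n] *)
Definition gammaD (n : nat) : {perm spoint n} :=
  bcycle (srange n 1 1) * bcycle (srange n 2 n).

(* Main.v *)
Require Import Defs.
From mathcomp Require Import all_boot all_fingroup all_algebra.
From mathcomp Require Import ring lra.

(** Let [e_1, ..., e_n] be the standard basis of Q^n and [e_{-i} = - e_i], so
    that a signed permutation [u] acts linearly.  Its moved space [M(u)] is the
    row space of [moved u], the matrix of [u - 1].

    Reflection length is a rank.  If a root [e_p - e_q] lies in [M(u)], then
    multiplying [u] by the corresponding reflection lowers the rank of [u - 1]
    by exactly one ([rank_moved_reflect]), and an even signed permutation other
    than the identity always moves such a root ([root_moved]); so the length of
    [u] is the dimension of [M(u)], and [u <= w] says that the rank of [w - 1]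
    is the sum of the ranks of [u - 1] and [w - u].

    Below gamma the order is inclusion of moved spaces.  Every signed point
    lies in a balanced cycle of gamma, so [G = gamma - 1] is invertible, and
    [u <= gamma] forces [A G^-1 A = A] for [A = u - 1] ([rank_sub_invmx]).
    Two consequences: for [u] and [v] below gamma, [u <= v] iff [M(u)] is
    contained in [M(v)] ([interval_dleE]); and on [M(u)] the Wall form
    [wall v w = <v, w G^-1>] can be computed from [u] instead of gamma
    ([wallE]).  Since [M(u)] contains [e_a - e_b] iff [a] and [b] are in the
    same cycle of [u] or both in balanced cycles ([linked]), the order is
    refinement of these noncrossing partitions, and the Wall form is what
    expresses noncrossing: it vanishes on roots from blocks that are neither
    equal nor opposite ([wall_unlinked]), but not on crossing roots of a cycle.

    Meets.  If neither of [x], [y] is below the other, one of them, say [x],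
    can be replaced by a smaller element [x * t] without losing a common lower
    bound.  For this it suffices to find a root [tau] in [M(x)] with
    [wall rho tau = 0] for all roots [rho] in [M(x)] and [M(y)]
    ([reduce_along_root]).  Such a root comes from cutting a cycle of [x]
    at two linked points of [y] ([separating_root_orbit]), or, when [x] and
    [y] both have a zero block and these meet only in the points 1 and -1,
    from cutting the zero block of [x] in two halves
    ([separating_root_zero_blocks]).  Iterating gives meets, and in a finite
    poset with a greatest element meets give joins ([lattice_of_meets]).

    About gamma the argument uses only that it is in [D_n] and that its orbits
    are the pair {1, -1} and the set of all other points. *)

Set Implicit Arguments.
Unset Strict Implicit.
Unset Printing Implicit Defensive.

Import GRing.Theory Num.Theory.

(** * Lattices from meets, and signed permutations *)

Section Lattice.

Variables (T : finType) (A : {set T}) (le : rel T).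

(** The join of [x] and [y] is an upper bound with as few elements below it as
    possible: its meet with any other upper bound is again an upper bound. *)
Lemma lattice_of_meets (top : T) :
  is_poset A le -> top \in A -> {in A, forall x, le x top} ->
  (forall x y, x \in A -> y \in A -> exists m, is_meet A le x y m) ->
  is_lattice A le.
Proof.
case=> refl_le asym_le trans_le At le_top meetA.
split=> // x y Ax Ay; split; first exact: meetA.
pose down j := [set z in A | le z j].
pose ub j := [&& j \in A, le x j & le y j].
have ub_top: ub top by rewrite /ub At !le_top.
case: (arg_minnP (fun j => #|down j|) ub_top) => j /and3P[Aj le_xj le_yj] min_j.
exists j; split=> // z Az le_xz le_yz.
have [m [Am le_mj le_mz glb_m]] := meetA _ _ Aj Az.
have down_sub: down m \subset down j.
  apply/subsetP=> t; rewrite !inE => /andP[At' le_tm]; rewrite At' /=.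
  exact: (trans_le m t j).
have /eqP down_eq: down m == down j.
  by rewrite eqEcard down_sub min_j // /ub Am !glb_m.
have: j \in down m by rewrite down_eq inE Aj refl_le.
by rewrite inE Aj /= => le_jm; apply: (trans_le m j z).
Qed.

End Lattice.

Section SignedPermutations.

Variable n : nat.
Implicit Types (p q r : spoint n) (u v w : {perm spoint n}).

Local Open Scope group_scope.

Lemma snegK : involutive (@sneg n).
Proof. by case=> i b; rewrite /sneg /= negbK. Qed.

Lemma sneg_neq p : sneg p != p.
Proof. by apply/eqP=> /(congr1 snd) /=; case: p.2. Qed.

Lemma abs_eqE p q : (p.1 == q.1) = (p == q) || (p == sneg q).
Proof.
case: p q => [i b] [j c]; rewrite /sneg !xpair_eqE /=.
by case: (i == j); case: b; case: c.
Qed.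

Lemma CnP u : reflect (forall p, u (sneg p) = sneg (u p)) (u \in Cn n).
Proof.
rewrite inE; apply: (iffP forallP) => Cu p; first by rewrite (eqP (Cu p)).
by rewrite Cu.
Qed.

Lemma CnM u v : u \in Cn n -> v \in Cn n -> u * v \in Cn n.
Proof.
by move=> /CnP Cu /CnP Cv; apply/CnP=> p; rewrite !permM Cu Cv.
Qed.

Lemma Cn_expg_sneg u i p : u \in Cn n -> (u ^+ i) (sneg p) = sneg ((u ^+ i) p).
Proof.
move=> /CnP Cu; elim: i => [|i IHi]; first by rewrite expg0 !perm1.
by rewrite expgSr !permM IHi Cu.
Qed.

Definition balanced_at u p := sneg p \in porbit u p.

(** [linked u] is the partition of the signed points attached to [u], in which
    all balanced cycles are merged into one zero block. *)
Definition linked u a b :=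
  (b \in porbit u a) || (balanced_at u a && balanced_at u b).

Lemma porbit_sneg u p q :
  u \in Cn n -> (sneg q \in porbit u (sneg p)) = (q \in porbit u p).
Proof.
move=> Cu; apply/porbitP/porbitP=> -[i]; rewrite ?Cn_expg_sneg // => eq_q.
  by exists i; apply: (inv_inj snegK).
by exists i; rewrite Cn_expg_sneg // eq_q.
Qed.

Lemma balanced_orbit u p q :
  u \in Cn n -> q \in porbit u p -> balanced_at u q = balanced_at u p.
Proof.
move=> Cu pq; rewrite /balanced_at.
have Npq: sneg q \in porbit u (sneg p) by rewrite porbit_sneg.
move: pq Npq; rewrite -!eq_porbit_mem => /eqP<- /eqP Npq.
by rewrite Npq.
Qed.

Lemma balanced_sneg u p : u \in Cn n -> balanced_at u (sneg p) = balanced_at u p.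
Proof.
by move=> Cu; rewrite /balanced_at porbit_sneg.
Qed.

Lemma linked_refl u a : linked u a a.
Proof. by rewrite /linked porbit_id. Qed.

Lemma linked_sym u a b : linked u a b = linked u b a.
Proof. by rewrite /linked porbit_sym andbC. Qed.

Lemma linked_trans u : u \in Cn n -> transitive (linked u).
Proof.
move=> Cu b a c; rewrite /linked => /orP[ab|/andP[Ba Bb]] /orP[bc|/andP[Bb' Bc]].
- by move: ab bc; rewrite -!eq_porbit_mem => /eqP<- ->.
- by rewrite -(balanced_orbit Cu ab) Bb' Bc orbT.
- by rewrite (balanced_orbit Cu bc) Ba Bb orbT.
- by rewrite Ba Bc orbT.
Qed.

Lemma linked_sneg u a b :
  u \in Cn n -> linked u (sneg a) (sneg b) = linked u a b.
Proof. by move=> Cu; rewrite /linked porbit_sneg // !balanced_sneg. Qed.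

Lemma linked_balanced u a b :
  u \in Cn n -> linked u a b -> balanced_at u a = balanced_at u b.
Proof.
move=> Cu /orP[ab|/andP[-> ->] //]; by rewrite (balanced_orbit Cu ab).
Qed.

Lemma linked_snegr u a : linked u a (sneg a) = balanced_at u a.
Proof.
rewrite /linked; case E: (balanced_at u a); last first.
  by rewrite -/(balanced_at u a) E.
by rewrite -/(balanced_at u a) E.
Qed.

Lemma linked_expg u p i : linked u p ((u ^+ i) p).
Proof. by rewrite /linked mem_porbit. Qed.

End SignedPermutations.

(** * Signed permutation matrices *)

Section SignedMatrices.

Variable n : nat.
Implicit Types (p q r : spoint n) (u v w : {perm spoint n}) (x y z : 'rV[rat]_n).

Local Open Scope ring_scope.

Definition evec p : 'rV[rat]_n := (-1) ^+ p.2 *: delta_mx 0 p.1.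

Definition dot x y : rat := (x *m y^T) 0 0.

Definition signed_mx u : 'M[rat]_n := \matrix_i evec (u (i, false)).

(** Vectors are rows, so that [signed_mx] turns the left-to-right product of
    permutations into the product of matrices; the row space of [moved u] is the
    moved space of [u]. *)
Definition moved u : 'M[rat]_n := signed_mx u - 1%:M.

Lemma evec_sneg p : evec (sneg p) = - evec p.
Proof. by rewrite /evec /=; case: p.2; rewrite ?expr1 ?expr0 scaleN1r scale1r ?opprK. Qed.

Lemma dotC x y : dot x y = dot y x.
Proof. by rewrite /dot -[x *m _]trmxK trmx_mul trmxK mxE. Qed.

Lemma dotDl x y z : dot (x + y) z = dot x z + dot y z.
Proof. by rewrite /dot mulmxDl mxE. Qed.

Lemma dotNl x z : dot (- x) z = - dot x z.
Proof. by rewrite /dot mulNmx mxE. Qed.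

Lemma dotBl x y z : dot (x - y) z = dot x z - dot y z.
Proof. by rewrite dotDl dotNl. Qed.

Lemma dotZl a x z : dot (a *: x) z = a * dot x z.
Proof. by rewrite /dot -scalemxAl mxE. Qed.

Lemma dotDr x y z : dot z (x + y) = dot z x + dot z y.
Proof. by rewrite !(dotC z) dotDl. Qed.

Lemma dotNr x z : dot z (- x) = - dot z x.
Proof. by rewrite !(dotC z) dotNl. Qed.

Lemma dotBr x y z : dot z (x - y) = dot z x - dot z y.
Proof. by rewrite dotDr dotNr. Qed.

Lemma dotZr a x z : dot z (a *: x) = a * dot z x.
Proof. by rewrite !(dotC z) dotZl. Qed.

Lemma dot_sumr (I : Type) (s : seq I) (P : pred I) (F : I -> 'rV[rat]_n) z :
  dot z (\sum_(i <- s | P i) F i) = \sum_(i <- s | P i) dot z (F i).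
Proof.
elim/big_rec2: _ => [|i a b _ IH]; first by rewrite /dot trmx0 mulmx0 mxE.
by rewrite dotDr IH.
Qed.

Lemma dot_evec p q : dot (evec p) (evec q) = (p == q)%:R - (p == sneg q)%:R.
Proof.
rewrite dotZl dotZr /dot trmx_delta mul_delta_mx_cond.
case: p q => [i b] [j c]; rewrite /sneg !xpair_eqE /=.
case: (i == j); rewrite !mxE /= ?mulr0n ?mulr1n ?mulr0; case: b; case: c => /=; ring.
Qed.

Lemma dot_evec_abs p q : p.1 != q.1 -> dot (evec p) (evec q) = 0.
Proof.
by rewrite abs_eqE negb_or dot_evec => /andP[/negPf-> /negPf->]; rewrite subrr.
Qed.

Lemma dot_evecxx p : dot (evec p) (evec p) = 1.
Proof. by rewrite dot_evec eqxx eq_sym (negPf (sneg_neq p)) subr0. Qed.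

Lemma evec_true (i : 'I_n) : evec (i, true) = - evec (i, false).
Proof. exact: (evec_sneg (i, false)). Qed.

Lemma evec_delta (i : 'I_n) : evec (i, false) = delta_mx 0 i.
Proof. by rewrite /evec /= expr0 scale1r. Qed.

Lemma evec_mx_eq m (A B : 'M[rat]_(n, m)) :
  (forall p, evec p *m A = evec p *m B) -> A = B.
Proof.
move=> eqAB; apply/row_matrixP=> i; rewrite !rowE -evec_delta; exact: eqAB.
Qed.

Lemma evec_sub m (A : 'M[rat]_n) (W : 'M[rat]_(m, n)) :
  (forall p, (evec p *m A <= W)%MS) -> (A <= W)%MS.
Proof.
by move=> sAW; apply/row_subP=> i; rewrite rowE -evec_delta sAW.
Qed.

Lemma evec_signed_mx u p : u \in Cn n -> evec p *m signed_mx u = evec (u p).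
Proof.
move=> /CnP Cu.
have E i : evec (i, false) *m signed_mx u = evec (u (i, false)).
  by rewrite evec_delta -rowE rowK.
case: p => i [|]; last exact: E.
by rewrite evec_true mulNmx E -evec_sneg -Cu.
Qed.

Lemma evec_moved u p : u \in Cn n -> evec p *m moved u = evec (u p) - evec p.
Proof. by move=> Cu; rewrite mulmxBr mulmx1 evec_signed_mx. Qed.

Lemma signed_mx1 : signed_mx 1 = 1%:M.
Proof.
by apply/row_matrixP=> i; rewrite rowK perm1 rowE mulmx1 evec_delta.
Qed.

Lemma signed_mxM u v : u \in Cn n -> v \in Cn n ->
  signed_mx (u * v)%g = signed_mx u *m signed_mx v.
Proof.
move=> Cu Cv; apply: evec_mx_eq => p.
by rewrite mulmxA !evec_signed_mx ?CnM // permM.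
Qed.

Lemma CnV u : u \in Cn n -> (u^-1)%g \in Cn n.
Proof.
move=> /CnP Cu; apply/CnP=> p; apply: (@perm_inj _ u).
by rewrite Cu !permKV.
Qed.

Lemma signed_mxKV u : u \in Cn n -> signed_mx u *m signed_mx (u^-1)%g = 1%:M.
Proof. by move=> Cu; rewrite -signed_mxM ?CnV // mulgV signed_mx1. Qed.

Lemma signed_mxVK u : u \in Cn n -> signed_mx (u^-1)%g *m signed_mx u = 1%:M.
Proof. by move=> Cu; rewrite -signed_mxM ?CnV // mulVg signed_mx1. Qed.

Lemma signed_mx_tr u : u \in Cn n -> (signed_mx u)^T = signed_mx (u^-1)%g.
Proof.
move=> Cu; apply/matrixP=> i j.
have coef M : (M : 'M[rat]_n) i j = dot (evec (i, false) *m M) (evec (j, false)).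
  rewrite !evec_delta /dot -rowE trmx_delta -colE !mxE.
  by [].
have coef' : (signed_mx u)^T i j = dot (evec (j, false) *m signed_mx u) (evec (i, false)).
  by rewrite mxE !evec_delta /dot -rowE trmx_delta -colE !mxE.
rewrite coef' coef !evec_signed_mx ?CnV // dotC !dot_evec.
by rewrite !(can2_eq (permKV u) (permK u)) (CnP _ Cu).
Qed.

Lemma dot_signed_mx u x y : u \in Cn n ->
  dot (x *m signed_mx u) (y *m signed_mx u) = dot x y.
Proof.
move=> Cu; rewrite /dot trmx_mul mulmxA -(mulmxA x).
by rewrite signed_mx_tr // signed_mxKV // mulmx1.
Qed.

(** As [v - u = u (u^-1 v - 1)], the rank of a difference is the length of a
    quotient. *)
Lemma rank_moved_div u v : u \in Cn n -> v \in Cn n ->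
  \rank (moved (u^-1 * v)%g) = \rank (moved v - moved u).
Proof.
move=> Cu Cv.
have -> : moved v - moved u = signed_mx u *m moved (u^-1 * v)%g.
  rewrite /moved signed_mxM ?CnV // mulmxBr mulmxA signed_mxKV // mul1mx mulmx1.
  by rewrite opprB addrA subrK.
have fullu : row_full (signed_mx u).
  by apply/row_fullP; exists (signed_mx (u^-1)%g); apply: signed_mxVK.
have freeu : signed_mx u \in unitmx.
  by rewrite -row_full_unit.
by rewrite eqmxMfull ?row_full_unit.
Qed.

Lemma sreflection_Cn p q : p.1 != q.1 -> sreflection p q \in Cn n.
Proof.
move=> pq; apply: (subsetP (Dn_sub_Cn n)); apply: mem_gen; rewrite inE.
by apply/existsP; exists p; apply/existsP; exists q; rewrite pq eqxx.
Qed.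

(** The root [e_p - e_q] has square norm 2, which is why the usual factor
    [2 / <tau, tau>] of the reflection formula does not show up. *)
Lemma sreflection_signed_mx p q x : p.1 != q.1 ->
  x *m signed_mx (sreflection p q) = x - dot x (evec p - evec q) *: (evec p - evec q).
Proof.
move=> pq.
set d := evec p - evec q.
suff -> : signed_mx (sreflection p q) = 1%:M - d^T *m d.
  rewrite mulmxBr mulmx1 mulmxA; congr (_ - _).
  by rewrite [x *m d^T]mx11_scalar mul_scalar_mx.
apply: evec_mx_eq => r.
rewrite evec_signed_mx ?sreflection_Cn // mulmxBr mulmx1 mulmxA.
rewrite [evec r *m d^T]mx11_scalar mul_scalar_mx -/(dot _ _).
rewrite {1}/d dotBr !dot_evec /d.
have := pq; rewrite abs_eqE negb_or => /andP[npq npNq].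
have nqNp : q != sneg p by apply: contra npNq => /eqP->; rewrite snegK.
have nNpq := nqNp; have nNqp := npNq; rewrite eq_sym in nNpq; rewrite eq_sym in nNqp.
have nqp := npq; rewrite eq_sym in nqp.
have npNp := sneg_neq p; have nqNq := sneg_neq q.
have nNN : sneg p != sneg q by rewrite (inj_eq (inv_inj (@snegK n))).
rewrite /sreflection permM.
have [-> | rp] := eqVneq r p.
  rewrite tpermL tpermD // ?(negPf npq) (eq_sym p) (negPf npNp) (negPf npNq) /=.
  by rewrite !subr0 scale1r opprB addrC subrK.
have [-> | rq] := eqVneq r q.
  rewrite tpermR tpermD // (negPf nqNp) (eq_sym q) (negPf nqNq) /=.
  by rewrite !sub0r !subr0 scaleN1r opprK addrC subrK.
have -> : tperm p q r = r by rewrite tpermD 1?eq_sym.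
have [-> | rNp] := eqVneq r (sneg p).
  rewrite tpermL (negPf nNN) !evec_sneg /=.
  by rewrite !subr0 !sub0r scaleN1r opprK addKr.
have [-> | rNq] := eqVneq r (sneg q).
  rewrite tpermR !evec_sneg /= !sub0r opprK scale1r opprB.
  by rewrite addKr.
by rewrite tpermD 1?eq_sym // !subr0 scale0r subr0.
Qed.

End SignedMatrices.

(** * Parity, and reflection length as a rank *)

Section Parity.

Lemma even_card_fixfree (T : finType) (f : T -> T) (A : {set T}) :
  involutive f -> {in A, forall x, f x \in A} -> {in A, forall x, f x != x} ->
  ~~ odd #|A|.
Proof.
move=> fK; have [k] := ubnP #|A|; elim: k A => // k IHk A leAk fA fN.
have [-> | [x Ax]] := set_0Vmem A; first by rewrite cards0.
have cA : #|A| = (#|A :\ x :\ f x|).+2.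
  by rewrite (cardsD1 x A) Ax (cardsD1 (f x) (A :\ x)) !inE fN ?fA.
rewrite cA /= negbK; apply: IHk.
- by move: leAk; rewrite cA ltnS => /ltnW.
- move=> y; rewrite !inE => /and3P[yf yx Ay].
  rewrite fA // andbT (inj_eq (inv_inj fK)) yx /=.
  by apply: contra yf => /eqP<-; rewrite fK.
- by move=> y; rewrite !inE => /and3P[_ _]; apply: fN.
Qed.

Variable n : nat.
Implicit Types (p q r : spoint n) (u v w : {perm spoint n}).

(** The parity argument for [D_n]: an even permutation of 2n points has an even
    number of orbits, [sneg] permutes these orbits, and its fixed points are the
    balanced ones; so the number of balanced orbits is even. *)
Lemma other_balanced u p : u \in Cn n -> ~~ odd_perm u -> balanced_at u p ->
  exists2 q, balanced_at u q & q \notin porbit u p.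
Proof.
move=> Cu even_u Bp.
have [/exists_inP[q Bq pq] | none] :=
  boolP [exists (q | balanced_at u q), q \notin porbit u p]; first by exists q.
have {none} only q : balanced_at u q -> q \in porbit u p.
  move=> Bq; apply: contraR none => pq; apply/exists_inP; by exists q.
have even_orb: ~~ odd #|porbits u|.
  move: even_u; rewrite /odd_perm card_prod card_bool muln2 odd_double.
  by case: (odd _).
(* If the orbit of [p] were the only balanced one, [sneg] would act without fixed
   points on the other orbits. *)
pose A := porbits u :\ porbit u p.
have: ~~ odd #|A|.
  apply: (@even_card_fixfree _ (fun O : {set spoint n} => [set sneg r | r in O])).
  - move=> O /=; rewrite -imset_comp -[RHS]imset_id.
    exact/eq_imset/snegK.
  - move=> O; rewrite !inE => /andP[neO /imsetP[q _ defO]].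
    have -> : [set sneg r | r in O] = porbit u (sneg q).
      apply/setP=> r; rewrite -[r]snegK (mem_imset _ _ (inv_inj (@snegK n))).
      by rewrite defO porbit_sneg.
    rewrite imset_f // andbT; apply: contra neO; rewrite eq_porbit_mem => pq.
    rewrite defO eq_porbit_mem -(eqP (_ : porbit u (sneg p) == porbit u p)).
      by rewrite -(snegK q) porbit_sneg.
    by rewrite eq_porbit_mem.
  - move=> O; rewrite !inE => /andP[neO /imsetP[q _ defO]].
    apply: contra neO => /eqP fixO; rewrite defO eq_porbit_mem only //.
    by rewrite /balanced_at -defO -fixO imset_f // defO porbit_id.
by move: even_orb; rewrite (cardsD1 (porbit u p)) imset_f //= -/A negbK => ->.
Qed.

Lemma RdP u : reflect (exists p q, p.1 != q.1 /\ u = sreflection p q) (u \in Rd n).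
Proof.
rewrite inE; apply: (iffP existsP) => [[p /existsP[q /andP[pq /eqP->]]] | [p [q [pq ->]]]].
  by exists p, q.
by exists p; apply/existsP; exists q; rewrite pq eqxx.
Qed.

Lemma odd_sreflection p q : p.1 != q.1 -> odd_perm (sreflection p q) = false.
Proof.
move=> pq; have npq : p != q by apply: contraNneq pq => ->.
by rewrite odd_permM !odd_tperm (inj_eq (inv_inj (@snegK n))) addbb.
Qed.

Lemma Dn_even u : u \in Dn n -> ~~ odd_perm u.
Proof.
case/gen_prodgP=> k [c Rc ->].
apply: (@big_ind _ (fun w => ~~ odd_perm w)) => [|v w|i _].
- by rewrite odd_perm1.
- by rewrite odd_permM => /negPf-> /negPf->.
- by have /RdP[p [q [pq ->]]] := Rc i; rewrite odd_sreflection.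
Qed.

Lemma Dn_Cn u : u \in Dn n -> u \in Cn n.
Proof. exact: (subsetP (Dn_sub_Cn n)). Qed.

Lemma sreflectionK p q : p.1 != q.1 -> (sreflection p q * sreflection p q = 1)%g.
Proof.
move=> pq; have Ct := CnP _ (sreflection_Cn pq).
apply/permP=> r; rewrite permM perm1.
move: pq; rewrite abs_eqE negb_or => /andP[npq npNq].
have nqNp : q != sneg p by apply: contra npNq => /eqP->; rewrite snegK.
have tp : sreflection p q p = q.
  by rewrite permM tpermL tpermD ?sneg_neq // eq_sym.
have tq : sreflection p q q = p.
  by rewrite permM tpermR tpermD ?sneg_neq // eq_sym.
have [-> | rp] := eqVneq r p; first by rewrite tp tq.
have [-> | rq] := eqVneq r q; first by rewrite tq tp.
have [-> | rNp] := eqVneq r (sneg p); first by rewrite !Ct tp tq.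
have [-> | rNq] := eqVneq r (sneg q); first by rewrite !Ct tq tp.
suff tr : sreflection p q r = r by rewrite !tr.
by rewrite permM !tpermD // eq_sym.
Qed.

End Parity.

Section Length.

Variable n : nat.
Implicit Types (p q r : spoint n) (u v w : {perm spoint n}) (x y z f : 'rV[rat]_n).

Local Open Scope ring_scope.

Lemma evec_inj : injective (@evec n).
Proof.
move=> p q eq_pq; have := dot_evecxx p; rewrite {2}eq_pq dot_evec.
by case: eqVneq => // _; case: (p == _).
Qed.

Lemma signed_mx_inj u v : u \in Cn n -> v \in Cn n -> signed_mx u = signed_mx v -> u = v.
Proof.
move=> Cu Cv eq_uv; apply/permP=> p; apply: evec_inj.
by rewrite -!evec_signed_mx // eq_uv.
Qed.

Lemma root_norm p q : p.1 != q.1 -> dot (evec p - evec q) (evec p - evec q) = 2%:R.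
Proof.
move=> pq; rewrite dotBl !dotBr !dot_evecxx (dotC (evec q)) dot_evec_abs //; ring.
Qed.

Section Descent.

Variables (u : {perm spoint n}) (p q : spoint n) (f : 'rV[rat]_n).
Hypotheses (Cu : u \in Cn n) (pq : p.1 != q.1)
  (def_f : f *m moved u = evec p - evec q).

Let t := sreflection p q.

Lemma mul_signed_mx_sub x : x *m signed_mx u = x *m moved u + x.
Proof. by rewrite mulmxBr mulmx1 subrK. Qed.

(** With [f u = f + tau], this is what [|f u| = |f|] gives. *)
Lemma dot_root_preimage : dot (evec p - evec q) f = -1.
Proof.
have E : dot (f *m signed_mx u) (f *m signed_mx u) = dot f f by apply: dot_signed_mx.
have := root_norm pq; move: E; rewrite mul_signed_mx_sub def_f.
move: (evec p - evec q) => d; rewrite dotDl !dotDr (dotC f d); lra.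
Qed.

Lemma mul_moved_reflect x :
  x *m moved (u * t)%g =
  x *m moved u - dot (x *m signed_mx u) (evec p - evec q) *: (evec p - evec q).
Proof.
rewrite mulmxBr mulmx1 signed_mxM ?sreflection_Cn // mulmxA sreflection_signed_mx //.
by rewrite mulmxBr mulmx1 addrAC.
Qed.

(** A preimage [g] of [x] under [u - 1] is still one under [u t - 1], because
    [g u] is orthogonal to the root [f u - f]. *)
Lemma moved_reflectP x :
  (x <= moved u)%MS -> dot x f = 0 -> (x <= moved (u * t)%g)%MS.
Proof.
case/submxP=> g -> gf0; apply/submxP; exists g; rewrite mul_moved_reflect.
suff -> : dot (g *m signed_mx u) (evec p - evec q) = 0 by rewrite scale0r subr0.
have -> : evec p - evec q = f *m signed_mx u - f by rewrite mul_signed_mx_sub def_f addrK.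
by rewrite dotBr dot_signed_mx // mul_signed_mx_sub dotDl gf0 add0r subrr.
Qed.

Lemma rank_movedM v w : v \in Cn n -> w \in Cn n ->
  (\rank (moved (v * w)%g) <= \rank (moved v) + \rank (moved w))%N.
Proof.
move=> Cv Cw.
have -> : moved (v * w)%g = moved v *m signed_mx w + moved w.
  by rewrite /moved signed_mxM // mulmxBl mul1mx addrA subrK.
by rewrite (leq_trans (mxrank_add _ _)) // leq_add2r mxrankM_maxl.
Qed.

Lemma rank_moved_sreflection : (\rank (moved t) <= 1)%N.
Proof.
have -> : moved t = - ((evec p - evec q)^T *m (evec p - evec q)).
  apply: evec_mx_eq => r; rewrite mulmxBr mulmx1 sreflection_signed_mx // mulmxN mulmxA.
  by rewrite addrAC subrr sub0r [evec r *m _]mx11_scalar mul_scalar_mx.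
by rewrite mxrank_opp (leq_trans (mxrankM_maxr _ _)) // rank_leq_row.
Qed.

(** The moved space of [u t] is contained in that of [u], and it is orthogonal
    to [f], which the root is not; so the rank drops, and it cannot drop by more
    than the rank one of [t - 1]. *)
Lemma rank_moved_reflect : \rank (moved u) = (\rank (moved (u * t)%g)).+1.
Proof.
have Ct : t \in Cn n by apply: sreflection_Cn.
have tau_u : (evec p - evec q <= moved u)%MS by apply/submxP; exists f.
apply/eqP; rewrite eqn_leq; apply/andP; split.
  have {1}-> : u = (u * t * t)%g by rewrite -mulgA sreflectionK ?mulg1.
  apply: leq_trans (rank_movedM (CnM Cu Ct) Ct) _.
  by rewrite -addn1 leq_add2l rank_moved_sreflection.
apply: rank_ltmx; apply/andP; split.
  apply: evec_sub => r; rewrite mul_moved_reflect addmx_sub ?submxMl //.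
  by rewrite eqmx_opp scalemx_sub.
have ortho_f x : (x <= moved (u * t)%g)%MS -> dot x f = 0.
  case/submxP=> g ->.
  have -> : g *m moved (u * t)%g = g *m signed_mx u *m signed_mx t - g.
    by rewrite mulmxBr mulmx1 signed_mxM // mulmxA.
  rewrite dotBl -(dot_signed_mx g f Cu) -(dot_signed_mx (_ *m signed_mx t) f Ct).
  rewrite -(mulmxA (g *m _)) -signed_mxM // (sreflectionK pq : t * t = 1)%g.
  rewrite signed_mx1 mulmx1.
  suff -> : f *m signed_mx t = f *m signed_mx u by rewrite subrr.
  rewrite sreflection_signed_mx // mul_signed_mx_sub def_f dotC dot_root_preimage.
  by rewrite scaleN1r opprK addrC.
apply/negP=> /(submx_trans tau_u) /ortho_f; rewrite dot_root_preimage.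
lra.
Qed.

End Descent.

Lemma expgs_sub_gen (gT : finGroupType) (A : {set gT}) k : (A ^+ k \subset <<A>>)%g.
Proof.
elim: k => [|k IHk]; first by rewrite expg0 sub1G.
by rewrite expgSr mul_subG ?subset_gen.
Qed.

Lemma moved_eq0 u : u \in Cn n -> moved u = 0 -> u = 1%g.
Proof.
move=> Cu /eqP; rewrite subr_eq0 => /eqP eq_u.
apply: signed_mx_inj => //; last by rewrite signed_mx1.
by apply/CnP=> p; rewrite !perm1.
Qed.

(** If [u] moves some coordinate axis, spanned by [e_p], [e_{u p} - e_p] is such
    a root; otherwise [u] is diagonal, and being even it negates at least two
    coordinates. *)
Lemma root_moved u : u \in Cn n -> ~~ odd_perm u -> u != 1%g ->
  exists p q, p.1 != q.1 /\ (evec p - evec q <= moved u)%MS.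
Proof.
move=> Cu even_u /eqP neq_u1.
have [/existsP[p abs_p] | diag_u] := boolP [exists p, (u p).1 != p.1].
  by exists (u p), p; rewrite -evec_moved ?submxMl.
have {}diag_u p : u p = p \/ u p = sneg p.
  move: diag_u; rewrite negb_exists => /forallP/(_ p); rewrite negbK abs_eqE.
  by case/orP=> /eqP; [left | right].
have neg_sub p : u p = sneg p -> (evec p <= moved u)%MS.
  move=> up; have -> : evec p = (- 2^-1 *: evec p) *m moved u.
    rewrite -scalemxAl evec_moved // up evec_sneg -opprD scaleNr scalerN opprK.
    by rewrite -mulr2n -scaler_nat scalerA mulVf ?scale1r.
  exact: submxMl.
have [p up] : exists p, u p = sneg p.
  have [/existsP[p /eqP up] | noN] := boolP [exists p, u p == sneg p].
    by exists p.
  case: neq_u1; apply/permP=> p; rewrite perm1; have [//|up] := diag_u p.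
  by case/existsP: noN; exists p; rewrite up.
have Bp : balanced_at u p by rewrite /balanced_at -up (mem_porbit u 1).
have [q Bq pq] := other_balanced Cu even_u Bp.
have uq : u q = sneg q.
  have [uq|//] := diag_u q.
  have fixq i : (u ^+ i)%g q = q.
    by elim: i => [|i IHi]; rewrite ?expg0 ?perm1 // expgSr permM IHi.
  case/porbitP: Bq => i; rewrite fixq => /eqP; by rewrite (negPf (sneg_neq q)).
exists p, q; split; last by rewrite addmx_sub ?eqmx_opp // neg_sub.
apply: contra pq; rewrite abs_eqE => /orP[/eqP-> | /eqP->]; first exact: porbit_id.
by rewrite -porbit_sneg // snegK; apply: Bq.
Qed.

(** Carter's lemma for [D_n], by descent along roots of the moved space. *)
Lemma mem_Rd_rank u : u \in Cn n -> ~~ odd_perm u ->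
  u \in (Rd n ^+ \rank (moved u))%g.
Proof.
have [k] := ubnP (\rank (moved u)); elim: k u => // k IHk u lek Cu even_u.
have [->|neq_u1] := eqVneq u 1%g.
  by rewrite /moved signed_mx1 subrr mxrank0 expg0 set11.
have [p [q [pq /submxP[f def_f]]]] := root_moved Cu even_u neq_u1.
have rk := rank_moved_reflect Cu pq (esym def_f).
rewrite rk expgSr -[X in X \in _]mulg1 -(sreflectionK pq) mulgA.
rewrite mem_mulg //; last by apply/RdP; exists p, q.
apply: IHk.
- by rewrite -ltnS -rk ltnS in lek *.
- by rewrite CnM // sreflection_Cn.
- by rewrite odd_permM odd_sreflection // addbF.
Qed.

Lemma mem_DnE u : (u \in Dn n) = (u \in Cn n) && ~~ odd_perm u.
Proof.
apply/idP/andP=> [Du | [Cu even_u]]; first by rewrite Dn_Cn ?Dn_even.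
by apply: (subsetP (expgs_sub_gen _ _)) (mem_Rd_rank Cu even_u).
Qed.

Lemma dlengthE u : u \in Dn n -> dlength u = \rank (moved u).
Proof.
move=> Du; have [Rk min_k] := abs_lengthP Du.
apply/eqP; rewrite eqn_leq min_k ?mem_Rd_rank ?Dn_Cn ?Dn_even //=.
rewrite -/(dlength u) in Rk *; move: (dlength u) Rk => k {min_k Du}.
elim: k u => [|k IHk] u.
  by rewrite expg0 => /set1P->; rewrite /moved signed_mx1 subrr mxrank0.
rewrite expgSr => /mulsgP[v w Rv Rw ->].
have Dv : v \in Dn n by apply: (subsetP (expgs_sub_gen _ _)) Rv.
have [p [q [pq def_w]]] := RdP _ Rw.
have Cw : w \in Cn n by rewrite def_w sreflection_Cn.
apply: leq_trans (rank_movedM (Dn_Cn Dv) Cw) _.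
by rewrite -addn1 leq_add ?IHk // def_w rank_moved_sreflection.
Qed.

Lemma dleE u w : u \in Dn n -> w \in Dn n ->
  dle u w = (\rank (moved w) == \rank (moved u) + \rank (moved w - moved u)%R)%N.
Proof.
move=> Du Dw; rewrite /dle !dlengthE ?groupM ?groupV //.
by rewrite rank_moved_div ?Dn_Cn.
Qed.

End Length.

(** * Rank-subtractive matrices and the Wall form *)

Section MinusOrder.

Variables (F : fieldType) (n : nat).
Implicit Types A B C G : 'M[F]_n.
Local Open Scope ring_scope.

Lemma rank_sub_submx A B :
  \rank B = (\rank A + \rank (B - A)%R)%N -> (A <= B)%MS.
Proof.
move=> rkB.
have sB : (B <= A + (B - A)%R)%MS by rewrite -{1}(subrK A B) addrC addmx_sub_adds.
have /geq_leqif := mxrank_leqif_sup sB.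
rewrite rkB (leq_trans (mxrank_adds_leqif _ _)) // => /esym/(submx_trans _); apply.
exact: addsmxSl.
Qed.

(** With [P = A G^-1], the ranks of [P] and [1 - P] add up to the dimension, so
    their row spaces meet trivially; as [P (1 - P)] lies in both, [P] is
    idempotent. *)
Lemma rank_sub_invmx A G : G \in unitmx ->
  \rank G = (\rank A + \rank (G - A)%R)%N -> A *m invmx G *m A = A.
Proof.
move=> Gu; set P := A *m invmx G.
have freeG : row_free (invmx G) by rewrite row_free_unit unitmx_inv.
have rkP : \rank P = \rank A by rewrite mxrankMfree.
have rkQ : \rank (1%:M - P) = \rank (G - A)%R.
  by rewrite -(mxrankMfree (G - A) freeG) mulmxBl mulmxV.
rewrite -rkP -rkQ => rkG.
have cap0 : (P :&: (1%:M - P))%MS = 0.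
  apply/eqP; rewrite -mxrank_eq0 -(eqn_add2l (\rank (P + (1%:M - P))%MS)).
  rewrite mxrank_sum_cap addn0 -rkG mxrank_unit // eqn_leq rank_leq_row andbT.
  rewrite -{1}(mxrank1 F n); apply: mxrankS.
  by rewrite -{1}(subrK P 1%:M) addrC addmx_sub_adds.
have PQ0 : P *m (1%:M - P) = 0.
  apply/eqP; rewrite -submx0 -cap0 sub_capmx submxMl andbT.
  by rewrite mulmxBr mulmx1 -{1}(mul1mx P) -mulmxBl submxMl.
move: PQ0; rewrite mulmxBr mulmx1 => /eqP; rewrite subr_eq0 => /eqP defP.
by rewrite -[X in _ *m X = _](mulmxKV Gu) -/P mulmxA -defP mulmxKV.
Qed.

(** The inclusions of row and column spaces make the idempotents [A G^-1] and
    [B G^-1] commute with product [A G^-1], so the latter splits off. *)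
Lemma invmx_rank_sub A B G : G \in unitmx ->
  B *m invmx G *m B = B -> (A <= B)%MS -> (A^T <= B^T)%MS ->
  A *m invmx G *m A = A -> \rank B = (\rank A + \rank (B - A)%R)%N.
Proof.
move=> Gu BB /submxP[C defA] /submxP[D defAT] AA.
have AB : A *m invmx G *m B = A by rewrite {1}defA -!mulmxA (mulmxA B) BB.
have BA : B *m invmx G *m A = A.
  by rewrite -[A]trmxK defAT trmx_mul trmxK !mulmxA BB.
pose P := A *m invmx G; pose Q := (B - A) *m invmx G.
have freeG : row_free (invmx G) by rewrite row_free_unit unitmx_inv.
rewrite -(mxrankMfree A freeG) -(mxrankMfree (B - A) freeG) -(mxrankMfree B freeG).
rewrite -/P -/Q; set R := B *m invmx G.
have PP : P *m P = P by rewrite /P mulmxA AA.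
have PR : P *m R = P by rewrite /P /R mulmxA AB.
have RP : R *m P = P by rewrite /P /R mulmxA BA.
have RR : R *m R = R by rewrite /R mulmxA BB.
have defQ : Q = R - P by rewrite /Q mulmxBl.
have cap0 : (P :&: Q)%MS = 0.
  apply/eqP; rewrite -submx0.
  have /submxP[c defc] := capmxSl P Q; have /submxP[d defd] := capmxSr P Q.
  have : (P :&: Q)%MS *m P = (P :&: Q)%MS by rewrite {1}defc -mulmxA PP -defc.
  by rewrite {1}defd -mulmxA defQ mulmxBl RP PP subrr mulmx0 => <-.
apply/eqP; rewrite eqn_leq; apply/andP; split.
  by rewrite -[R](subrK P) -defQ addrC mxrank_add.
rewrite -mxrank_sum_cap cap0 mxrank0 addn0 mxrankS // addsmx_sub.
rewrite -{1}PR submxMl defQ -{1}RR -{1}PR -mulmxBl submxMl.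
by [].
Qed.

End MinusOrder.

Section Wall.

Variable n : nat.
Implicit Types (a b p q r : spoint n) (u x z : {perm spoint n}) (v w f g : 'rV[rat]_n).

Local Open Scope ring_scope.

(** The telescoping sum that gives explicit preimages under [u - 1]. *)
Definition path_sum u p m := \sum_(i < m) evec ((u ^+ i)%g p).

Lemma path_sum_moved u p m : u \in Cn n ->
  path_sum u p m *m moved u = evec ((u ^+ m)%g p) - evec p.
Proof.
move=> Cu; rewrite /path_sum; elim: m => [|m IHm].
  by rewrite big_ord0 mul0mx expg0 perm1 subrr.
rewrite big_ord_recr mulmxDl IHm evec_moved //= expgSr permM.
by rewrite addrC addrA subrK.
Qed.

Lemma dot_evec_sum (A : {set spoint n}) a :
  dot (evec a) (\sum_(t in A) evec t) = (a \in A)%:R - (sneg a \in A)%:R.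
Proof.
have count_mem r : \sum_(t in A) (r == t)%:R = (r \in A)%:R :> rat.
  have [Ar | nAr] := boolP (r \in A).
    rewrite (bigD1 r) //= eqxx big1 ?addr0 // => t /andP[_].
    by rewrite eq_sym => /negPf->.
  by rewrite big1 // => t At; case: eqP => // rt; rewrite rt At in nAr.
rewrite dot_sumr -!count_mem -sumrB; apply: eq_bigr => t _.
by rewrite dot_evec (can2_eq (@snegK n) (@snegK n)).
Qed.

Lemma moved_tr u : u \in Cn n -> (moved u)^T = - (signed_mx (u^-1)%g *m moved u).
Proof.
move=> Cu; rewrite linearB /= trmx1 signed_mx_tr //.
by rewrite mulmxBr mulmx1 signed_mxVK // opprB.
Qed.

Lemma moved_trK u : u \in Cn n -> moved u = - (signed_mx u *m (moved u)^T).
Proof.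
by move=> Cu; rewrite moved_tr // mulmxN mulmxA signed_mxKV // mul1mx opprK.
Qed.

(** No two of the first [j] points of the [u]-orbit of [p] are equal or opposite,
    so their vectors are part of an orthonormal basis. *)
Definition simple_path u p j := forall i, (0 < i < j)%N ->
  (u ^+ i)%g p != p /\ (u ^+ i)%g p != sneg p.

Lemma dot_simple_path u p j a : u \in Cn n -> simple_path u p j ->
  let S := [set (u ^+ i)%g p | i : 'I_j] in
  [/\ dot (evec a) (path_sum u p j) = (a \in S)%:R - (sneg a \in S)%:R
    & a \in S -> sneg a \notin S].
Proof.
move=> Cu simp S.
have expg_diff i k : (i <= k)%N -> (u ^+ k)%g p = (u ^+ (k - i))%g ((u ^+ i)%g p).
  by move=> le_ik; rewrite -permM -expgD subnKC.
have diff_eq i k : (i < k)%N -> (k < j)%N -> (u ^+ i)%g p != (u ^+ k)%g p.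
  move=> lt_ik lt_kj; apply/eqP=> E.
  have /simp[/eqP[]] : (0 < k - i < j)%N.
    by rewrite subn_gt0 lt_ik (leq_ltn_trans (leq_subr _ _)).
  apply: (@perm_inj _ (u ^+ i)%g).
  by rewrite -permM -expgD subnK ?(ltnW lt_ik) // E.
have diff_opp i k : (i <= k)%N -> (k < j)%N -> (u ^+ i)%g p != sneg ((u ^+ k)%g p).
  move=> le_ik lt_kj; apply/eqP=> E.
  have [eq_ik | lt_ik] := eqVneq i k.
    by have := sneg_neq ((u ^+ k)%g p); rewrite -E eq_ik eqxx.
  have /simp[_ /eqP[]] : (0 < k - i < j)%N.
    by rewrite subn_gt0 ltn_neqAle lt_ik le_ik (leq_ltn_trans (leq_subr _ _)).
  apply: (@perm_inj _ (u ^+ i)%g).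
  by rewrite -permM -expgD subnK // Cn_expg_sneg // E snegK.
split.
  rewrite -dot_evec_sum big_imset //= => i k _ _ E; apply/val_inj.
  case: (ltngtP (val i) (val k)) => // lt; last first.
    by have := diff_eq _ _ lt (ltn_ord i); rewrite E eqxx.
  by have := diff_eq _ _ lt (ltn_ord k); rewrite E eqxx.
case/imsetP=> i _ ->; apply/imsetP=> -[k _ E].
case: (leqP (val i) (val k)) => le.
  by have := diff_opp _ _ le (ltn_ord k); rewrite -E snegK eqxx.
by have := diff_opp _ _ (ltnW le) (ltn_ord i); rewrite E eqxx.
Qed.

Lemma linked_moved u a b : u \in Cn n -> linked u a b ->
  (evec a - evec b <= moved u)%MS.
Proof.
move=> Cu; have orb_sub p q : q \in porbit u p -> (evec q - evec p <= moved u)%MS.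
  case/porbitP=> i ->; rewrite -path_sum_moved //; exact: submxMl.
have bal_sub p : balanced_at u p -> (evec p <= moved u)%MS.
  move=> /orb_sub; rewrite evec_sneg -opprD -mulr2n -scaler_nat -scaleNr.
  by rewrite eqmx_scale.
rewrite /linked => /orP[|/andP[Ba Bb]]; last by rewrite addmx_sub ?eqmx_opp ?bal_sub.
by rewrite porbit_sym; apply: orb_sub.
Qed.

(** The sum over an orbit is fixed by [u], hence orthogonal to the moved space. *)
Lemma orbit_sum_fixed u a v : u \in Cn n -> (v <= moved u)%MS ->
  dot v (\sum_(t in porbit u a) evec t) = 0.
Proof.
move=> Cu /submxP[g ->]; set k := \sum_(t in _) _.
have fix_k : k *m signed_mx u = k.
  rewrite mulmx_suml [RHS](reindex_inj (@perm_inj _ u)) /=.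
  apply: eq_big => [t | t _]; last by rewrite evec_signed_mx.
  by rewrite -!eq_porbit_mem -[X in porbit u (u X)]/(id t) -(porbit_perm u 1 t) expg1.
by rewrite mulmxBr mulmx1 dotBl -{1}fix_k dot_signed_mx // subrr.
Qed.

(** A nonbalanced orbit containing only one of [a] and [b] would have a sum with
    nonzero inner product with [e_a - e_b]. *)
Lemma moved_linked u a b : u \in Cn n -> (evec a - evec b <= moved u)%MS ->
  linked u a b.
Proof.
move=> Cu sub_ab; rewrite /linked.
have sum0 c : dot (evec a - evec b) (\sum_(t in porbit u c) evec t) = 0.
  exact: orbit_sum_fixed.
have [Ba /= | nBa] := boolP (balanced_at u a).
  have [Bb | nBb] := boolP (balanced_at u b); first by rewrite orbT.
  have := sum0 b; rewrite dotBl !dot_evec_sum porbit_id -/(balanced_at u b).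
  rewrite (negPf nBb) porbit_sym; case: (b \in _) => //=; case: (sneg a \in _) => /=; lra.
have := sum0 a; rewrite dotBl !dot_evec_sum porbit_id -/(balanced_at u a).
rewrite (negPf nBa); case: (b \in _) => //=; case: (sneg b \in _) => /=; lra.
Qed.

Section BelowFullElement.

Variable gam : {perm spoint n}.
Hypotheses (Cg : gam \in Cn n) (Bg : forall p, balanced_at gam p).

Let G := moved gam.

Lemma moved_full_unit : G \in unitmx.
Proof.
rewrite -row_full_unit -sub1mx; apply: evec_sub => p; rewrite mulmx1.
have : (evec p - evec (sneg p) <= G)%MS.
  by apply: linked_moved => //; rewrite linked_snegr Bg.
rewrite evec_sneg opprK -mulr2n -scaler_nat.
by rewrite eqmx_scale.
Qed.

Definition below u := u \in Cn n /\ moved u *m invmx G *m moved u = moved u.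

(** The Wall form of [gam]. *)
Definition wall v w := dot v (w *m invmx G).

Lemma below_self : below gam.
Proof. by split=> //; rewrite mulmxV ?mul1mx ?moved_full_unit. Qed.

(** The Wall form of [u] is the restriction of the Wall form of [gam]:
    [f (u - 1) G^-1] and [f] differ by a vector fixed by [u], which is
    orthogonal to the moved space of [u]. *)
Lemma wallE u v f : below u -> (v <= moved u)%MS -> wall v (f *m moved u) = dot v f.
Proof.
case=> Cu AA /submxP[g ->]; rewrite /wall; apply/eqP; rewrite -subr_eq0 -dotBr.
(* [k] is the discrepancy between the preimages of [w] under [G] and [u - 1]. *)
set k := _ - f; have kA : k *m moved u = 0.
  by rewrite mulmxBl -!mulmxA (mulmxA (moved u)) AA subrr.
have kAT : k *m (moved u)^T = 0.
  have ku : k *m signed_mx u = k by rewrite mul_signed_mx_sub kA add0r.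
  rewrite moved_tr // mulmxN mulmxA -{1}ku -(mulmxA k) signed_mxKV // mulmx1 kA oppr0.
  by [].
by rewrite dotC /dot trmx_mul mulmxA kAT mul0mx mxE.
Qed.

Lemma wallNl v w : wall (- v) w = - wall v w.
Proof. exact: dotNl. Qed.
Lemma wallBl v1 v2 w : wall (v1 - v2) w = wall v1 w - wall v2 w.
Proof. exact: dotBl. Qed.
Lemma wallDr v w1 w2 : wall v (w1 + w2) = wall v w1 + wall v w2.
Proof. by rewrite /wall mulmxDl dotDr. Qed.
Lemma wallNr v w : wall v (- w) = - wall v w.
Proof. by rewrite /wall mulNmx dotNr. Qed.
Lemma wallBr v w1 w2 : wall v (w1 - w2) = wall v w1 - wall v w2.
Proof. by rewrite wallDr wallNr. Qed.

(** Since [gam] is orthogonal, the symmetric part of the Wall form is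
    [- <v, w> / 2]; the rest of the information is in the skew part. *)
Lemma wall_sym v w : wall v w + wall w v = - dot v w.
Proof.
have subG (t : 'rV[rat]_n) : (t <= G)%MS.
  by rewrite submx_full // row_full_unit moved_full_unit.
have /submxP[g defv] := subG v; have /submxP[h defw] := subG w.
rewrite {1}defw (wallE _ below_self) // {2}defv (wallE _ below_self) //.
have E : dot (g *m signed_mx gam) (h *m signed_mx gam) = dot g h by apply: dot_signed_mx.
move: E; rewrite !mul_signed_mx_sub -/G -defv -defw !dotDl !dotDr (dotC g w).
lra.
Qed.

End BelowFullElement.

End Wall.

(** * Values of the Wall form on orbits *)

Section Preimages.

Variable n : nat.
Implicit Types (a b p q r : spoint n) (u : {perm spoint n}).
Local Open Scope ring_scope.

Lemma balanced_moved u p : u \in Cn n -> balanced_at u p -> (evec p <= moved u)%MS.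
Proof.
move=> Cu; rewrite -linked_snegr => /(linked_moved Cu).
by rewrite evec_sneg opprK -mulr2n -scaler_nat eqmx_scale.
Qed.

Lemma dot_path_sum_unlinked u p r m a : u \in Cn n -> linked u p r ->
  ~~ linked u a p -> ~~ linked u a (sneg p) ->
  dot (evec a) (path_sum u r m) = 0.
Proof.
move=> Cu pr nap naNp; rewrite dot_sumr big1 // => i _; rewrite dot_evec.
have pt : linked u p ((u ^+ i)%g r) := linked_trans Cu pr (linked_expg u r i).
case: eqVneq => [E | _]; first by rewrite linked_sym E pt in nap.
case: eqVneq => [E | _]; first by rewrite linked_sym E linked_sneg // pt in naNp.
by rewrite subrr.
Qed.

Lemma balanced_preimage u p k : u \in Cn n -> (u ^+ k)%g p = sneg p ->
  (- 2^-1 *: path_sum u p k) *m moved u = evec p.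
Proof.
move=> Cu up; rewrite -scalemxAl path_sum_moved // up evec_sneg.
by rewrite -opprD scaleNr scalerN opprK -mulr2n -scaler_nat scalerA mulVf ?scale1r.
Qed.

(** The preimage can be chosen supported on the blocks of [p] and [- p]. *)
Lemma linked_preimage u p q : u \in Cn n -> linked u p q ->
  exists2 f, f *m moved u = evec p - evec q &
    forall a, ~~ linked u a p -> ~~ linked u a (sneg p) -> dot (evec a) f = 0.
Proof.
move=> Cu pq; have [|/andP[/porbitP[k pk] /porbitP[l ql]]] := orP pq.
  rewrite porbit_sym => /porbitP[i def_p]; exists (path_sum u q i).
    by rewrite path_sum_moved // -def_p.
  by move=> a; apply: dot_path_sum_unlinked.
exists (- 2^-1 *: path_sum u p k - - 2^-1 *: path_sum u q l).
  by rewrite mulmxBl !balanced_preimage.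
move=> a nap naNp; rewrite dotBr !dotZr.
by rewrite !(dot_path_sum_unlinked _ Cu _ nap naNp) ?linked_refl ?mulr0 ?subrr.
Qed.

(** Half of a balanced cycle through [q]: the points from [q] up to [- q]. *)
Definition half_period u q k := [/\ (0 < k)%N, (u ^+ k)%g q = sneg q
  & forall i, (0 < i < k)%N -> (u ^+ i)%g q != sneg q].

Lemma half_periodP u q : balanced_at u q -> exists k, half_period u q k.
Proof.
move=> /porbitP[k0 def0].
have ex_k : exists k, (0 < k)%N && ((u ^+ k)%g q == sneg q).
  exists k0; rewrite -def0 eqxx andbT lt0n; apply: contra (sneg_neq q) => /eqP k00.
  by rewrite def0 k00 expg0 perm1.
case: (ex_minnP ex_k) => k /andP[k_gt0 /eqP def_k] min_k.
exists k; split=> // i /andP[i_gt0 lt_ik].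
by apply: contraL lt_ik => Ei; rewrite -leqNgt min_k // i_gt0.
Qed.

Lemma half_period_simple u q k : half_period u q k -> simple_path u q k.
Proof.
case=> k_gt0 def_k min_k i /andP[i_gt0 lt_ik]; split; last by rewrite min_k ?i_gt0.
apply/eqP=> ui; have /min_k/eqP[] : (0 < k - i < k)%N.
  by rewrite subn_gt0 lt_ik ltn_subrL i_gt0.
by rewrite -def_k -[in RHS](subnKC (ltnW lt_ik)) expgD permM ui.
Qed.

Lemma half_period_normal u p q k : u \in Cn n -> half_period u q k ->
  p \in porbit u q ->
  exists2 i, (i < k)%N & p = (u ^+ i)%g q \/ p = sneg ((u ^+ i)%g q).
Proof.
move=> Cu [k_gt0 def_k _] /porbitP[m ->]; elim: m => [|m [i lt_ik IHm]].
  by exists 0%N => //; left.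
rewrite expgSr permM; have [lt_Sik | ] := ltnP i.+1 k.
  exists i.+1 => //; rewrite expgSr permM.
  by case: IHm => ->; [left | right; rewrite (CnP _ Cu)].
rewrite leq_eqVlt ltnS leqNgt lt_ik orbF => /eqP def_i.
have Si : u ((u ^+ i)%g q) = sneg q by rewrite -permM -expgSr -def_i.
exists 0%N => //; rewrite expg0 perm1.
by case: IHm => ->; rewrite ?(CnP _ Cu) Si; [right | left; rewrite snegK].
Qed.

Lemma half_period_expg u q k j : u \in Cn n -> half_period u q k ->
  half_period u ((u ^+ j)%g q) k.
Proof.
move=> Cu [k_gt0 def_k min_k]; have com i :
  (u ^+ i)%g ((u ^+ j)%g q) = (u ^+ j)%g ((u ^+ i)%g q).
  by rewrite -!permM -!expgD addnC.
split=> // [|i lt_ik]; first by rewrite com def_k Cn_expg_sneg.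
by rewrite com -Cn_expg_sneg // (inj_eq perm_inj) min_k.
Qed.

End Preimages.

Section WallValues.

Variables (n : nat) (gam : {perm spoint n}).
Hypotheses (Cg : gam \in Cn n) (Bg : forall p, balanced_at gam p).
Implicit Types (a b p q r : spoint n) (u : {perm spoint n}).
Local Open Scope ring_scope.

Let below := below gam.
Definition beta p q := wall gam (evec p) (evec q).

Lemma beta_snegl p q : beta (sneg p) q = - beta p q.
Proof. by rewrite /beta evec_sneg wallNl. Qed.

Lemma beta_snegr p q : beta p (sneg q) = - beta p q.
Proof. by rewrite /beta evec_sneg wallNr. Qed.

Lemma beta_skew p q : p.1 != q.1 -> beta q p = - beta p q.
Proof.
by move=> pq; have := wall_sym Cg Bg (evec p) (evec q); rewrite dot_evec_abs // /beta; lra.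
Qed.

Lemma beta_diag p : beta p p = - 2^-1.
Proof. by have := wall_sym Cg Bg (evec p) (evec p); rewrite dot_evecxx /beta; lra. Qed.

Lemma wall_rootE a b p q : wall gam (evec a - evec b) (evec p - evec q) =
  beta a p - beta a q - beta b p + beta b q.
Proof. rewrite wallBl !wallBr /beta; ring. Qed.

(** Noncrossing in algebraic form: by [wallE] only a preimage of [e_p - e_q] under
    [u - 1] matters, and it can be supported on the blocks of [p] and [- p]. *)
Lemma wall_unlinked u a b p q : below u -> linked u a b -> linked u p q ->
  ~~ linked u a p -> ~~ linked u a (sneg p) ->
  wall gam (evec a - evec b) (evec p - evec q) = 0.
Proof.
move=> ub ab pq nap naNp; have [Cu _] := ub.
have nb r : ~~ linked u a r -> ~~ linked u b r by apply/contra/linked_trans.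
have [f <- f0] := linked_preimage Cu pq.
rewrite (wallE _ ub) ?linked_moved //.
by rewrite dotBl !f0 ?subrr // nb.
Qed.

Lemma betaE u p q k : below u -> balanced_at u p -> (u ^+ k)%g q = sneg q ->
  beta p q = - 2^-1 * dot (evec p) (path_sum u q k).
Proof.
move=> ub Bp uq; have [Cu _] := ub.
rewrite /beta -{1}(balanced_preimage Cu uq) (wallE _ ub) ?dotZr //.
exact: balanced_moved.
Qed.

(** On a balanced cycle of [u] the sign of [beta p q] tells whether [p] lies in
    the half cycle that starts at [q]; so all elements below [gam] that are
    balanced at both points agree with [gam] on this. *)
Lemma beta_half u q k i : below u -> half_period u q k -> (i < k)%N ->
  beta ((u ^+ i)%g q) q = - 2^-1.
Proof.
move=> ub hq lt_ik; have [Cu _] := ub; have [_ def_k _] := hq.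
have Bq : balanced_at u q by rewrite /balanced_at -def_k mem_porbit.
rewrite (betaE ub _ def_k); last by rewrite (balanced_orbit Cu (mem_porbit u i q)).
have [-> nS] := dot_simple_path ((u ^+ i)%g q) Cu (half_period_simple hq).
have S_i : (u ^+ i)%g q \in [set (u ^+ i)%g q | i : 'I_k].
  by apply/imsetP; exists (Ordinal lt_ik).
by rewrite S_i (negPf (nS S_i)) subr0 mulr1.
Qed.

(** Applied both to [gam] and to an element [u] below it, this shows that two
    points balanced for [u] are in the same orbit of [u] iff they are in the same
    orbit of [gam]. *)
Lemma beta_eq0 u p q : below u -> balanced_at u p -> balanced_at u q ->
  (beta p q == 0) = (p \notin porbit u q).
Proof.
move=> ub Bp Bq; have [Cu _] := ub; have [k hq] := half_periodP Bq.
have [pq | npq] /= := boolP (p \in porbit u q).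
  have [i lt_ik [->|->]] := half_period_normal Cu hq pq.
    by rewrite (beta_half ub hq).
  by rewrite beta_snegl (beta_half ub hq).
have [_ def_k _] := hq; rewrite (betaE ub Bp def_k) dot_sumr big1 ?mulr0 ?eqxx // => i _.
rewrite dot_evec; case: eqVneq => [E | _]; first by rewrite E mem_porbit in npq.
case: eqVneq => [E | _]; last by rewrite subrr.
by case/negP: npq; rewrite E -Cn_expg_sneg // -def_k -permM -expgD mem_porbit.
Qed.

(** Three points of a nonbalanced cycle lie in a half-plane, in the following
    sense: their three [beta] are neither all positive nor all negative.  Indeed
    [wall (e_p - e_q) (e_q - e_r)] is 0 or 1, according to the cyclic order. *)
Lemma beta_triple u p q r : below u -> ~~ balanced_at u p ->
  q \in porbit u p -> r \in porbit u p -> p != q -> q != r -> p != r ->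
  beta p q + beta q r + beta r p = 2^-1 \/ beta p q + beta q r + beta r p = - 2^-1.
Proof.
move=> ub nBp pq pr npq nqr npr; have [Cu _] := ub.
have abs_neq a b : a \in porbit u p -> b \in porbit u p -> a != b -> a.1 != b.1.
  move=> pa pb nab; rewrite abs_eqE negb_or nab /=; apply: contra nBp => /eqP def_a.
  rewrite -(balanced_orbit Cu pb) /balanced_at -def_a.
  by move: pa pb; rewrite -!eq_porbit_mem => /eqP-> /eqP->.
have pp := porbit_id u p.
have nBr : ~~ balanced_at u r by rewrite (balanced_orbit Cu pr).
have rq : q \in porbit u r by move: pq pr; rewrite -!eq_porbit_mem => /eqP-> /eqP->.
have ex_m : exists m, (u ^+ m)%g r == q by case/porbitP: rq => m ->; exists m.
case: (ex_minnP ex_m) => m /eqP def_m min_m.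
(* By minimality of [m], the path from [r] to [q] is simple. *)
have simp : simple_path u r m.
  move=> i /andP[i_gt0 lt_im]; split; apply/eqP=> E; last first.
    by case/negP: nBr; rewrite /balanced_at -E mem_porbit.
  have : (m <= m - i)%N.
    apply: min_m; rewrite -def_m -[X in _ == (u ^+ X)%g r](subnKC (ltnW lt_im)).
    by rewrite expgD permM E.
  by rewrite leqNgt ltn_subrL i_gt0 (leq_trans _ lt_im).
set S := [set (u ^+ i)%g r | i : 'I_m].
have dotS a : a \in porbit u p -> dot (evec a) (path_sum u r m) = (a \in S)%:R.
  move=> pa; have [-> _] := dot_simple_path a Cu simp.
  suff /negPf-> : sneg a \notin S by rewrite subr0.
  apply: contra nBp => /imsetP[i _ def_a]; rewrite -(balanced_orbit Cu pa).
  rewrite /balanced_at def_a; move: pa pr; rewrite -!eq_porbit_mem => /eqP-> /eqP<-.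
  by rewrite eq_porbit_mem mem_porbit.
have qS : q \notin S.
  apply/imsetP=> -[i _ E]; have := ltn_ord i; rewrite ltnNge min_m //.
  by rewrite E.
have linked_p a : a \in porbit u p -> linked u p a by rewrite /linked => ->.
have E : wall gam (evec p - evec q) (evec q - evec r) = (p \in S)%:R.
  rewrite -[evec q in X in wall _ _ X]/(evec q) -{2}def_m -path_sum_moved //.
  rewrite (wallE _ ub) ?linked_moved ?linked_p //.
  by rewrite dotBl !dotS // (negPf qS) subr0.
move: E; rewrite wall_rootE beta_diag (beta_skew (abs_neq r p _ _ _)) // 1?eq_sym //.
by case: (p \in S) => /= E; [left | right]; move: E; lra.
Qed.

End WallValues.

(** * Meets below an element with two orbits *)

Section Interval.

Variables (n : nat) (gam : {perm spoint n}) (c : spoint n).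
Hypotheses (Dg : gam \in Dn n)
  (Og : forall p q, (p \in porbit gam q) = ((p.1 == c.1) == (q.1 == c.1))).
Implicit Types (a b p q r : spoint n) (u x y z : {perm spoint n}).
Local Open Scope ring_scope.

Let Cg : gam \in Cn n := Dn_Cn Dg.
Let Bg p : balanced_at gam p.
Proof. by rewrite /balanced_at Og. Qed.

Local Notation below := (below gam).
Local Notation wall := (wall gam).
Local Notation beta := (beta gam).

Lemma interval_Dn u : u \in dinterval gam -> u \in Dn n.
Proof. by rewrite inE => /andP[]. Qed.

Lemma below_interval u : u \in dinterval gam -> below u.
Proof.
rewrite inE => /andP[Du]; rewrite dleE // => /eqP rk; split; first exact: Dn_Cn.
by apply: rank_sub_invmx => //; apply: moved_full_unit.
Qed.

Lemma dle_trans u y z : u \in Dn n -> y \in Dn n -> z \in Dn n ->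
  dle u y -> dle y z -> dle u z.
Proof.
move=> Du Dy Dz; rewrite !dleE // => /eqP rk_uy /eqP rk_yz.
rewrite eqn_leq -{1}(subrK (moved u) (moved z)) {1}addrC mxrank_add /=.
rewrite rk_yz rk_uy -addnA leq_add2l addnC.
have -> : moved z - moved u = (moved z - moved y) + (moved y - moved u).
  by rewrite addrA subrK.
exact: mxrank_add.
Qed.

Lemma dle_refl u : u \in Dn n -> dle u u.
Proof. by move=> Du; rewrite dleE // subrr mxrank0 addn0. Qed.

Lemma dinterval_poset : is_poset (dinterval gam) (@dle n).
Proof.
split=> [u /interval_Dn Du | u v /interval_Dn Du /interval_Dn Dv | v u w].
- exact: dle_refl.
- rewrite !dleE // => /andP[/eqP rk_v /eqP rk_u].
  have /eqP : \rank (moved v - moved u)%R = 0%N.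
    by apply/eqP; rewrite -leqn0 -(leq_add2l (\rank (moved u))) -rk_v rk_u addn0 leq_addr.
  rewrite mxrank_eq0 subr_eq0 => /eqP eq_uv.
  apply: signed_mx_inj; rewrite ?Dn_Cn //; apply: (@addIr _ (- 1%:M)).
  exact: esym eq_uv.
- by move=> /interval_Dn Dv /interval_Dn Du /interval_Dn Dw; apply: dle_trans.
Qed.

Lemma interval_dleE u v : u \in dinterval gam -> v \in dinterval gam ->
  dle u v = (moved u <= moved v)%MS.
Proof.
move=> Iu Iv; have [Cu uu] := below_interval Iu; have [Cv vv] := below_interval Iv.
rewrite dleE ?interval_Dn //; apply/eqP/idP=> [|sub_uv]; first exact: rank_sub_submx.
apply: (invmx_rank_sub (moved_full_unit Cg Bg)) => //.
rewrite moved_tr // eqmx_opp (submx_trans (submxMl _ _)) // (submx_trans sub_uv) //.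
by rewrite {1}(moved_trK Cv) eqmx_opp submxMl.
Qed.

(** For [u] in [D_n] the moved space is spanned by the roots in it.  A vector
    [e_p] with [u p = - p] needs a second balanced orbit: there [2 e_p] is the
    sum of the roots [e_p - e_q] and [e_p + e_q]. *)
Lemma moved_sub_roots u m (W : 'M[rat]_(m, n)) : u \in Dn n ->
  (forall a b, a.1 != b.1 -> linked u a b -> (evec a - evec b <= W)%MS) ->
  (moved u <= W)%MS.
Proof.
move=> Du subW; have Cu := Dn_Cn Du; apply: evec_sub => p; rewrite evec_moved //.
have [abs_p | ] := eqVneq (u p).1 p.1; last first.
  by move=> abs_p; rewrite subW // linked_sym (linked_expg u p 1).
move/eqP: abs_p; rewrite abs_eqE => /orP[/eqP-> | /eqP up].
  by rewrite subrr sub0mx.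
have Bp : balanced_at u p by rewrite /balanced_at -up (mem_porbit u 1).
have [q Bq npq] := other_balanced Cu (Dn_even Du) Bp.
have abs_pq : p.1 != q.1.
  apply: contra npq; rewrite eq_sym abs_eqE => /orP[/eqP-> | /eqP->] //.
  exact: porbit_id.
have -> : evec (u p) - evec p = - ((evec p - evec q) + (evec p - evec (sneg q))).
  by rewrite up !evec_sneg opprK addrACA addNr addr0 opprD.
rewrite eqmx_opp addmx_sub // subW // /linked ?balanced_sneg // Bp Bq orbT //.
Qed.

(** As [wall rho tau] is [<rho, f>] with [f (x - 1) = tau], the hypothesis says
    that the roots of a common lower bound survive in the moved space of
    [x t]. *)
Lemma reduce_along_root x y s t :
  x \in dinterval gam -> s.1 != t.1 -> (evec s - evec t <= moved x)%MS ->
  (forall a b, a.1 != b.1 -> linked x a b -> linked y a b ->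
     wall (evec a - evec b) (evec s - evec t) = 0) ->
  y \in dinterval gam ->
  exists2 x', x' \in dinterval gam & [/\ dle x' x, (dlength x' < dlength x)%N
    & forall z, z \in dinterval gam -> dle z x -> dle z y -> dle z x'].
Proof.
move=> Ix abs_st /submxP[f def_f] orth Iy.
have Dx := interval_Dn Ix; have Cx := Dn_Cn Dx.
pose t' := sreflection s t; have Dt : t' \in Dn n.
  by apply: mem_gen; apply/RdP; exists s, t.
have rk := rank_moved_reflect Cx abs_st (esym def_f).
have Dx' : (x * t')%g \in Dn n by rewrite groupM.
have le_x'x : dle (x * t')%g x.
  rewrite /dle !dlengthE // ?groupM ?groupV // -/t' in rk *.
  rewrite invMg mulgKV rk -/t' -addn1 eqn_add2l.
  have -> : t'^-1%g = t'.
    by apply: (mulgI t'); rewrite mulgV sreflectionK.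
  have lenx : (\rank (moved t') <= 1)%N by apply: rank_moved_sreflection.
  rewrite eqn_leq lenx andbT lt0n mxrank_eq0; apply/eqP=> t'0.
  have t1 := moved_eq0 (Dn_Cn Dt) t'0.
  by move: rk; rewrite t1 mulg1 => /eqP; rewrite eqn_leq ltnn andbF.
have Ix' : (x * t')%g \in dinterval gam.
  rewrite inE Dx' (dle_trans Dx' Dx Dg) //.
  by move: Ix; rewrite inE => /andP[].
exists (x * t')%g => //; split=> // [|z Iz].
  by rewrite !dlengthE // rk.
rewrite !interval_dleE // => zx zy.
apply: moved_sub_roots (interval_Dn Iz) _ => a b abs_ab.
move=> /(linked_moved (Dn_Cn (interval_Dn Iz))) zab.
have xab := submx_trans zab zx; have yab := submx_trans zab zy.
apply: (moved_reflectP Cx abs_st (esym def_f)) => //.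
rewrite -(wallE _ (below_interval Ix)) // -def_f orth //; apply: moved_linked => //.
exact/Dn_Cn/interval_Dn.
Qed.

Lemma beta_neq0 p q : (beta p q != 0) = ((p.1 == c.1) == (q.1 == c.1)).
Proof. by rewrite (beta_eq0 (below_self Cg Bg)) // negbK Og. Qed.

(** If [y] links the chord from [p] to [q] to the opposite of the chord from [a]
    to [b], then the two chords do not cross in the cycle of [x].  Comparing the
    triples [(p, q, r)] in [x] and [(p, q, - r)] in [y] shows that [p] and [q] are
    on the same side of each of the points [r = a, b], unless [beta p q = 0];
    symmetrically for [a] and [b].
    Both exceptions would put two of the four points at [c] or [- c]. *)
Lemma wall_opposite_linked x y p q a b : below x -> below y ->
  ~~ balanced_at x p -> ~~ balanced_at y p ->
  q \in porbit x p -> a \in porbit x p -> b \in porbit x p ->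
  q \in porbit y p -> sneg a \in porbit y p -> sneg b \in porbit y p ->
  a != p -> a != q -> b != p -> b != q ->
  wall (evec a - evec b) (evec q - evec p) = 0.
Proof.
move=> xb yb nxp nyp xq xa xb' yq ya yb' nap naq nbp nbq.
have [Cx _] := xb; have [Cy _] := yb.
have [-> | nqp] := eqVneq q p; first by rewrite wall_rootE; ring.
have [-> | nab] := eqVneq a b; first by rewrite wall_rootE; ring.
have abs_neq r s : r \in porbit x p -> s \in porbit x p -> r != s -> r.1 != s.1.
  move=> pr ps nrs; rewrite abs_eqE negb_or nrs /=; apply: contra nxp => /eqP def_r.
  rewrite -(balanced_orbit Cx ps) /balanced_at -def_r.
  by move: pr ps; rewrite -!eq_porbit_mem => /eqP-> /eqP->.
have xp := porbit_id x p; have yp := porbit_id y p.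
have sk r s : r \in porbit x p -> s \in porbit x p -> r != s -> beta s r = - beta r s.
  by move=> xr xs nrs; rewrite (beta_skew Cg Bg) // abs_neq.
have nNneg r s : r \in porbit x p -> s \in porbit x p -> r != sneg s.
  move=> xr xs; apply: contra nxp => /eqP def_r.
  rewrite -(balanced_orbit Cx xs) /balanced_at -def_r.
  by move: xr xs; rewrite -!eq_porbit_mem => /eqP-> /eqP->.
rewrite wall_rootE.
have pq_side r : r \in porbit x p -> sneg r \in porbit y p -> r != p -> r != q ->
    beta p q != 0 -> beta r p = beta r q.
  move=> xr yr nrp nrq /eqP nz.
  have := beta_triple Cg Bg xb nxp xq xr; have := beta_triple Cg Bg yb nyp yq yr.
  rewrite (eq_sym p) nqp (eq_sym q r) nrq (eq_sym p r) nrp !nNneg //.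
  move=> /(_ isT isT isT) Ty /(_ isT isT isT) Tx; move: Ty Tx.
  rewrite beta_snegl beta_snegr (sk r q) //.
  by case=> Ty; case=> Tx; move: Tx Ty nz; lra.
have ab_side r : r \in porbit x p -> r \in porbit y p -> a != r -> b != r ->
    beta a b != 0 -> beta a r = beta b r.
  move=> xr yr nar nbr /eqP nz.
  have nxa : ~~ balanced_at x a by rewrite (balanced_orbit Cx xa).
  have nya : ~~ balanced_at y (sneg a) by rewrite (balanced_orbit Cy ya).
  have toa s : s \in porbit x p -> s \in porbit x a.
    by move: xa; rewrite -!eq_porbit_mem => /eqP->.
  have toNa s : s \in porbit y p -> s \in porbit y (sneg a).
    by move: ya; rewrite -!eq_porbit_mem => /eqP->.
  have := beta_triple Cg Bg xb nxa (toa _ xb') (toa _ xr).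
  have := beta_triple Cg Bg yb nya (toNa _ yb') (toNa _ yr).
  rewrite (inj_eq (inv_inj (@snegK n))) nab nbr nar ![sneg _ == r]eq_sym !nNneg //.
  move=> /(_ isT isT isT) Ty /(_ isT isT isT) Tx; move: Ty Tx.
  rewrite !beta_snegl !beta_snegr (sk a r) //.
  by case=> Ty; case=> Tx; move: Tx Ty nz; lra.
have [pq0 | nz] := eqVneq (beta p q) 0; last first.
  by rewrite !pq_side //; ring.
have [ab0 | nz] := eqVneq (beta a b) 0; last first.
  by rewrite (ab_side q) // (ab_side p) //; ring.
move: (beta_neq0 p q) (beta_neq0 a b); rewrite pq0 ab0 eqxx /=.
have ne r s : r \in porbit x p -> s \in porbit x p -> r != s ->
    r.1 == c.1 -> s.1 == c.1 -> False.
  by move=> xr xs nrs /eqP rc /eqP sc; have := abs_neq r s xr xs nrs; rewrite rc sc eqxx.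
case Ep: (p.1 == c.1); case Eq: (q.1 == c.1) => // _;
case Ea: (a.1 == c.1); case Eb: (b.1 == c.1) => // _.
- by case: (ne a p).
- by case: (ne b p).
- by case: (ne a q).
- by case: (ne b q).
Qed.

(** Let [p' = x^j p] be the first return of the [x]-orbit of [p] to the [y]-block
    of [p].  By noncrossing, no [y]-block joins the open arc from [p] to [p']
    to the rest of the cycle of [x], so that this arc can be split off, by the
    reflection exchanging [p'] and [x p].  If the cycle is balanced, [- p] has
    to be in the [y]-block of [p], for the arc to stop before [- p]. *)
Lemma separating_root_orbit x y p : x \in dinterval gam -> y \in dinterval gam ->
  ~~ linked y p (x p) -> ~~ balanced_at x p || balanced_at y p ->
  exists s t, [/\ s.1 != t.1, (evec s - evec t <= moved x)%MS
    & forall a b, linked x a b -> linked y a b ->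
        wall (evec a - evec b) (evec s - evec t) = 0].
Proof.
move=> Ix Iy np cond.
have xB := below_interval Ix; have yB := below_interval Iy.
have [Cx _] := xB; have [Cy _] := yB.
have ex_j : exists j, (0 < j)%N && linked y p ((x ^+ j)%g p).
  by exists #[x]%g; rewrite order_gt0 expg_order perm1 linked_refl.
case: (ex_minnP ex_j) => j /andP[j_gt0 yj] min_j.
have {}min_j i : (0 < i < j)%N -> ~~ linked y p ((x ^+ i)%g p).
  case/andP=> i_gt0; apply: contraL => yi; rewrite -leqNgt min_j // i_gt0.
  by [].
set p' := (x ^+ j)%g p in yj.
have simp : simple_path x p j.
  move=> i lt_i; split; apply/eqP=> E; have := min_j i lt_i; rewrite E.
    by rewrite linked_refl.
  rewrite linked_snegr; case/orP: cond => [/negP[]|-> //].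
  by rewrite /balanced_at -E mem_porbit.
have dotS a := dot_simple_path a Cx simp.
set S := [set (x ^+ i)%g p | i : 'I_j] in dotS.
have Sp : p \in S by apply/imsetP; exists (Ordinal j_gt0); rewrite //= expg0 perm1.
have S_link a : a \in S -> linked y p a -> a = p.
  case/imsetP=> i _ -> yi; have [-> | i_gt0] := posnP (val i); first by rewrite perm1.
  by have := min_j i; rewrite i_gt0 ltn_ord yi => /(_ isT).
have S_orb a : a \in S -> a \in porbit x p by case/imsetP=> i _ ->; apply: mem_porbit.
(* [f] is the sum over the open arc from [p] to [p']. *)
pose f := path_sum x p j - evec p.
have def_f : f *m moved x = evec p' - evec (x p).
  rewrite mulmxBl path_sum_moved // evec_moved // -/p'.
  by rewrite opprB addrA subrK.
exists p', (x p); split.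
- rewrite abs_eqE negb_or; apply/andP; split; apply: contra np => /eqP E.
    by rewrite -E.
  case/orP: cond => [/negP[]|Bp].
    rewrite -(balanced_orbit Cx (mem_porbit x 1 p)) expg1 /balanced_at -E.
    have := mem_porbit x 1 p; rewrite -eq_porbit_mem expg1 => /eqP->.
    exact: mem_porbit.
  rewrite -linked_sneg // -E -linked_snegr in Bp *.
  by rewrite (linked_trans Cy _ yj) // linked_sym.
- by rewrite -def_f submxMl.
(* Compare [wall (e_a - e_b) (e_p' - e_p)] computed in [y], where it vanishes, and
   in [x], where it is the inner product with the sum over [S]. *)
have inside a b : a \in S -> a != p -> linked x a b -> linked y a b -> b \in S /\ b != p.
  move=> Sa nap xab yab.
  have nya : ~~ linked y a p by apply: contra nap => ?; rewrite (S_link a) // linked_sym.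
  have nbp : b != p by apply: contraNneq nya => <-.
  split=> //; have xpa := S_orb a Sa.
  have w0 : wall (evec a - evec b) (evec p' - evec p) = 0.
    have [yaN | nyaN] := boolP (linked y a (sneg p)); last first.
      have yp'p : linked y p' p by rewrite linked_sym.
      apply: (wall_unlinked yB) => //.
        by apply: contra nya => /(linked_trans Cy); apply.
      apply: contra nyaN => /(linked_trans Cy); apply.
      by rewrite linked_sneg.
    have nyp : ~~ balanced_at y p.
      apply: contra nya; rewrite -linked_snegr linked_sym; exact: linked_trans.
    have nxp : ~~ balanced_at x p by rewrite (negPf nyp) orbF in cond.
    have linkedE u r s : ~~ balanced_at u r -> linked u r s -> s \in porbit u r.
      by rewrite /linked => /negPf->; rewrite orbF.
    have nxa : ~~ balanced_at x a by rewrite (balanced_orbit Cx xpa).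
    have yNa : linked y p (sneg a).
      by rewrite -(linked_sneg _ _ Cy) snegK linked_sym.
    have yNb : linked y p (sneg b).
      by apply: (linked_trans Cy) yNa _; rewrite linked_sneg.
    apply: (wall_opposite_linked xB yB nxp nyp) => //.
    + exact: mem_porbit.
    + have := linkedE _ _ _ nxa xab; move: xpa; rewrite -!eq_porbit_mem => /eqP->.
      by [].
    + exact: linkedE.
    + exact: linkedE.
    + exact: linkedE.
    + by apply: contraNneq nya => ->; rewrite linked_sym.
    + by apply: contraNneq nya => E; rewrite (linked_trans Cy yab) // E linked_sym.
  move: w0; rewrite -(path_sum_moved _ _ Cx) (wallE _ xB) ?linked_moved //.
  have [dSa /(_ Sa)/negPf nSa] := dotS a; have [dSb _] := dotS b.
  rewrite dotBl dSa dSb Sa nSa; case: (b \in S) => //=.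
  by case: (sneg b \in S) => /=; lra.
move=> a b xab yab; rewrite -def_f (wallE _ xB) ?linked_moved //.
(* [I] is the open arc; [f] takes equal values on linked points because both [I]
   and its opposite are unions of common blocks. *)
pose I := S :\ p.
have same r s : linked x r s -> linked y r s -> (r \in I) = (s \in I).
  move=> xrs yrs; apply/idP/idP; rewrite !inE => /andP[nr Sr].
    by have [-> ->] := inside r s Sr nr xrs yrs.
  have [||-> ->] := inside s r Sr nr; by rewrite // linked_sym.
have dot_f r : dot (evec r) f = (r \in I)%:R - (sneg r \in I)%:R.
  have [dSr ndis] := dotS r; rewrite dotBr dSr dot_evec !inE.
  rewrite (can2_eq (@snegK n) (@snegK n)).
  have [-> | nrp] /= := eqVneq r p.
    have [_ /(_ Sp)/negPf->] := dotS p.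
    by rewrite Sp (eq_sym p) (negPf (sneg_neq p)) ?andbF /=; ring.
  have [-> | nrNp] /= := eqVneq r (sneg p); last by ring.
  have [_ /(_ Sp)/negPf->] := dotS p.
  by rewrite snegK Sp /=; ring.
by rewrite dotBl !dot_f (same a b) // (same (sneg a) (sneg b)) ?linked_sneg // subrr.
Qed.

(** A second balanced orbit of [u] exists by parity; were both away from [c],
    they would be in one orbit of [gam], hence in one orbit of [u]. *)
Lemma balanced_center u p : u \in dinterval gam -> balanced_at u p -> balanced_at u c.
Proof.
move=> Iu Bp; have [Cu _] := below_interval Iu.
have [q Bq npq] := other_balanced Cu (Dn_even (interval_Dn Iu)) Bp.
have at_c r : balanced_at u r -> r.1 == c.1 -> balanced_at u c.
  by move=> Br; rewrite abs_eqE => /orP[/eqP<- | /eqP def_r] //;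
    rewrite -(balanced_sneg _ Cu) -def_r.
have := beta_neq0 q p; rewrite (beta_eq0 (below_interval Iu)) // npq /=.
case Eq: (q.1 == c.1); first by move=> _; apply: (at_c q).
by case Ep: (p.1 == c.1) => // _; apply: (at_c p).
Qed.

Lemma outer_orbit u p q : u \in dinterval gam -> balanced_at u p -> balanced_at u q ->
  p.1 != c.1 -> q.1 != c.1 -> p \in porbit u q.
Proof.
move=> Iu Bp Bq np nq; rewrite -[_ \in _]negbK -(beta_eq0 (below_interval Iu)) //.
by rewrite beta_neq0 (negPf np) (negPf nq).
Qed.

(** Away from [c] and [- c], the zero blocks of [x] and [y] turn out to be
    disjoint.  There the points [q] and [- q] cut the zero block of [x] into two
    opposite halves that no [y]-block joins.  The root is [e_s + e_c] with
    [s] the first point of the zero block of [x] that follows [q] in the cycle of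
    [gam]; the corresponding reflection turns the zero block into a nonbalanced
    cycle formed by [c] and one half, and its opposite. *)
Lemma separating_root_zero_blocks x y p q : x \in dinterval gam -> y \in dinterval gam ->
  (forall r, ~~ linked y r (x r) -> balanced_at x r && ~~ balanced_at y r) ->
  balanced_at x p -> ~~ balanced_at y p ->
  balanced_at y q -> ~~ balanced_at x q ->
  exists s t, [/\ s.1 != t.1, (evec s - evec t <= moved x)%MS
    & forall a b, a.1 != b.1 -> linked x a b -> linked y a b ->
        wall (evec a - evec b) (evec s - evec t) = 0].
Proof.
move=> Ix Iy cond Bxp nByp Byq nBxq.
have xB := below_interval Ix; have yB := below_interval Iy.
have [Cx _] := xB; have [Cy _] := yB.
have Bxc := balanced_center Ix Bxp; have Byc := balanced_center Iy Byq.
have at_c u r : u \in Cn n -> balanced_at u c -> r.1 == c.1 -> balanced_at u r.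
  by move=> Cu Bc; rewrite abs_eqE => /orP[/eqP-> | /eqP->] //; rewrite balanced_sneg.
have outp : p.1 != c.1 by apply: contra nByp; apply: at_c.
have outq : q.1 != c.1 by apply: contra nBxq; apply: at_c.
(* The zero block of [x] outside of [c] is a single orbit of [x]; a common point
   with the zero block of [y] would propagate along this orbit up to [p]. *)
have disj r : r.1 != c.1 -> balanced_at x r -> ~~ balanced_at y r.
  move=> outr Bxr; apply: contra nByp => Byr.
  have /porbitP[i ->] := outer_orbit Ix Bxp Bxr outp outr.
  elim: i => [|i IHi]; first by rewrite expg0 perm1.
  rewrite expgSr permM; set t := (x ^+ i)%g r in IHi *.
  have [yt | /cond] := boolP (linked y t (x t)); first by rewrite -(linked_balanced Cy yt).
  by rewrite IHi andbF.
have [N hN] := half_periodP (Bg q).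
have pos r i : balanced_at x r -> r = (gam ^+ i)%g q -> (0 < i)%N.
  move=> Br def_r; rewrite lt0n; apply: contra nBxq => /eqP i0.
  by rewrite def_r i0 expg0 perm1 in Br.
have normal r : balanced_at x r -> r.1 != c.1 ->
  exists i, [/\ (0 < i < N)%N, balanced_at x ((gam ^+ i)%g q)
    & r = (gam ^+ i)%g q \/ r = sneg ((gam ^+ i)%g q)].
  move=> Br outr; have rq : r \in porbit gam q by rewrite Og (negPf outr) (negPf outq).
  have [i lt_iN def_r] := half_period_normal Cg hN rq.
  have Bi : balanced_at x ((gam ^+ i)%g q).
    by case: def_r Br => ->; rewrite ?balanced_sneg.
  by exists i; split=> //; rewrite lt_iN (pos _ _ Bi).
have ex_i : exists i, (0 < i)%N && balanced_at x ((gam ^+ i)%g q).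
  by have [i [/andP[i_gt0 _] Bi _]] := normal p Bxp outp; exists i; rewrite i_gt0.
case: (ex_minnP ex_i) => i0 /andP[i0_gt0 Bs] min_i0.
set s := (gam ^+ i0)%g q in Bs.
have outs : s.1 != c.1.
  by have := Og s q; rewrite mem_porbit (negPf outq); case: (s.1 == c.1).
(* By minimality of [i0], the half cycles of [gam] that start at [q] and at [s]
   contain the same points of the zero block of [x]. *)
have same r : balanced_at x r -> r.1 != c.1 -> beta r s = beta r q.
  move=> Br outr; have [i [/andP[i_gt0 lt_iN] Bi def_r]] := normal r Br outr.
  have le_i0i : (i0 <= i)%N by rewrite min_i0 // i_gt0.
  have gB := below_self Cg Bg.
  have bq : beta ((gam ^+ i)%g q) q = - 2^-1 by apply: (beta_half gB hN).
  have bs : beta ((gam ^+ i)%g q) s = - 2^-1.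
    rewrite -(subnKC le_i0i) expgD permM -/s.
    apply: (beta_half gB (half_period_expg i0 Cg hN)).
    exact: leq_ltn_trans (leq_subr _ _) lt_iN.
  by case: def_r => ->; rewrite ?beta_snegl bq bs.
have sc : linked x s (sneg c) by rewrite /linked Bs balanced_sneg // Bxc orbT.
exists s, (sneg c); split=> [//||a b abs_ab xab yab]; first exact: linked_moved.
have Bxab := linked_balanced Cx xab; have Byab := linked_balanced Cy yab.
have [Bxa | nBxa] := boolP (balanced_at x a); last first.
  apply: (wall_unlinked xB) => //; apply: contra nBxa => /(linked_balanced Cx)->.
    by [].
  by rewrite balanced_sneg.
have Bxb : balanced_at x b by rewrite -Bxab.
have outa : a.1 != c.1.
  apply/negP=> ac; have outb : b.1 != c.1 by rewrite -(eqP ac) eq_sym.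
  by have /negP[] := disj b outb Bxb; rewrite -Byab; apply: at_c.
have outb : b.1 != c.1.
  apply/negP=> bc; have /negP[] := disj a outa Bxa.
  by rewrite Byab; apply: at_c.
have nBya := disj a outa Bxa.
(* The root [e_q - e_{-q}] is [2 e_q], so [a] and [b] are on the same side of [q]. *)
have w0 : wall (evec a - evec b) (evec q - evec (sneg q)) = 0.
  apply: (wall_unlinked yB) => //; first by rewrite linked_snegr.
    by apply: contra nBya => /(linked_balanced Cy)->.
  by apply: contra nBya => /(linked_balanced Cy)->; rewrite balanced_sneg.
have bc r : r.1 != c.1 -> beta r c = 0.
  by move=> outr; apply/eqP; rewrite -[_ == 0]negbK beta_neq0 eqxx (negPf outr).
move: w0; rewrite !wall_rootE !beta_snegr !same // !bc //; lra.
Qed.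

Lemma not_dle_unlinked x y : x \in dinterval gam -> y \in dinterval gam ->
  ~~ dle x y -> exists p, ~~ linked y p (x p).
Proof.
move=> Ix Iy; rewrite interval_dleE // => nle; apply/existsP.
apply: contraR nle; rewrite negb_exists => /forallP all_p.
have [Cx _] := below_interval Ix; have [Cy _] := below_interval Iy.
apply: evec_sub => p; rewrite evec_moved //; apply: linked_moved => //.
by rewrite linked_sym -[linked _ _ _]negbK.
Qed.

(** When neither [x] nor [y] can be reduced by cutting a cycle, both have points
    in their zero block that are outside the zero block of the other. *)
Lemma reduce_pair x y : x \in dinterval gam -> y \in dinterval gam ->
  ~~ dle x y -> ~~ dle y x ->
  exists x' y', [/\ x' \in dinterval gam, y' \in dinterval gam, dle x' x, dle y' y
    & (dlength x' + dlength y' < dlength x + dlength y)%N /\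
      forall z, z \in dinterval gam -> dle z x -> dle z y -> dle z x' /\ dle z y'].
Proof.
move=> Ix Iy nxy nyx.
have reduce u v s t : u \in dinterval gam -> v \in dinterval gam ->
    s.1 != t.1 -> (evec s - evec t <= moved u)%MS ->
    (forall a b, a.1 != b.1 -> linked u a b -> linked v a b ->
       wall (evec a - evec b) (evec s - evec t) = 0) -> 
    exists2 u', u' \in dinterval gam & [/\ dle u' u, (dlength u' < dlength u)%N
      & forall z, z \in dinterval gam -> dle z u -> dle z v -> dle z u'].
  by move=> Iu Iv st sub orth; apply: reduce_along_root sub orth Iv.
have left_case s t : s.1 != t.1 -> (evec s - evec t <= moved x)%MS ->
    (forall a b, a.1 != b.1 -> linked x a b -> linked y a b ->
       wall (evec a - evec b) (evec s - evec t) = 0) ->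
    exists x' y', [/\ x' \in dinterval gam, y' \in dinterval gam, dle x' x, dle y' y
    & (dlength x' + dlength y' < dlength x + dlength y)%N /\
      forall z, z \in dinterval gam -> dle z x -> dle z y -> dle z x' /\ dle z y'].
  move=> st sub orth.
  have [x' Ix' [le_x' lt_x' glb_x']] := reduce _ _ _ _ Ix Iy st sub orth.
  exists x', y; split=> //; first exact/dle_refl/interval_Dn.
  by split=> [|z Iz zx zy]; [rewrite ltn_add2r | rewrite glb_x'].
have [/existsP[p /andP[np cond]] | nox] := boolP
    [exists p, ~~ linked y p (x p) && (~~ balanced_at x p || balanced_at y p)].
  have [s [t [st sub orth]]] := separating_root_orbit Ix Iy np cond.
  by apply: left_case st sub _ => a b _; apply: orth.
have [/existsP[p /andP[np cond]] | noy] := boolP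
    [exists p, ~~ linked x p (y p) && (~~ balanced_at y p || balanced_at x p)].
  have [s [t [st sub orth]]] := separating_root_orbit Iy Ix np cond.
  have [|y' Iy' [le_y' lt_y' glb_y']] := reduce _ _ _ _ Iy Ix st sub.
    by move=> a b _; apply: orth.
  exists x, y'; split=> //; first exact/dle_refl/interval_Dn.
  by split=> [|z Iz zx zy]; [rewrite ltn_add2l | rewrite glb_y'].
have [p np] := not_dle_unlinked Ix Iy nxy; have [q nq] := not_dle_unlinked Iy Ix nyx.
have condx r : ~~ linked y r (x r) -> balanced_at x r && ~~ balanced_at y r.
  move=> nr; move: nox; rewrite negb_exists => /forallP/(_ r).
  by rewrite nr /= negb_or negbK.
have condy r : ~~ linked x r (y r) -> balanced_at y r && ~~ balanced_at x r.
  move=> nr; move: noy; rewrite negb_exists => /forallP/(_ r).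
  by rewrite nr /= negb_or negbK.
have /andP[Bxp nByp] := condx p np; have /andP[Byq nBxq] := condy q nq.
have [s [t [st sub orth]]] := separating_root_zero_blocks Ix Iy condx Bxp nByp Byq nBxq.
exact: left_case st sub orth.
Qed.

Lemma interval_meet x y : x \in dinterval gam -> y \in dinterval gam ->
  exists m, is_meet (dinterval gam) (@dle n) x y m.
Proof.
have [k] := ubnP (dlength x + dlength y)%N; elim: k x y => // k IHk x y lek Ix Iy.
have [xy | nxy] := boolP (dle x y).
  by exists x; split=> //; apply/dle_refl/interval_Dn.
have [yx | nyx] := boolP (dle y x).
  by exists y; split=> //; apply/dle_refl/interval_Dn.
have [x' [y' [Ix' Iy' le_x' le_y' [lt glb']]]] := reduce_pair Ix Iy nxy nyx.
have [|m [Im mx my glb_m]] := IHk x' y' _ Ix' Iy'; first exact: leq_trans lt lek.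
have tr u v w : u \in dinterval gam -> v \in dinterval gam -> w \in dinterval gam ->
    dle u v -> dle v w -> dle u w.
  by move=> Iu Iv Iw; apply: dle_trans; apply: interval_Dn.
exists m; split=> //; [exact: tr mx le_x' | exact: tr my le_y' |].
by move=> z Iz zx zy; have [zx' zy'] := glb' z Iz zx zy; apply: glb_m.
Qed.

Lemma two_orbit_interval_lattice : is_lattice (dinterval gam) (@dle n).
Proof.
apply: (lattice_of_meets (top := gam)); first exact: dinterval_poset.
- by rewrite inE Dg dle_refl.
- by move=> x; rewrite inE => /andP[].
- exact: interval_meet.
Qed.

End Interval.

(** * The orbits of gamma *)

Section Gamma.

Variable n : nat.
Implicit Types (p q : spoint n) (s : seq (spoint n)).

Lemma next_notin (T : eqType) (s : seq T) x : x \notin s -> next s x = x.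
Proof. by rewrite next_nth => /negPf->. Qed.

Lemma porbit_next (T : finType) (u : {perm T}) (s : seq T) x y : uniq s ->
  {in s, u =1 next s} -> y \in s -> (x \in porbit u y) = (x \in s).
Proof.
move=> Us us sy.
have iter_u i : iter i u y = iter i (next s) y /\ iter i u y \in s.
  elim: i => [|i [eq_i s_i]] //=; rewrite us // -eq_i; split=> //.
  by rewrite mem_next.
apply/porbitP/idP=> [[i ->] | sx]; first by rewrite permX; case: (iter_u i).
have : fconnect (next s) y x by rewrite (fconnect_cycle (cycle_next Us)).
move=> /iter_findex def_x; exists (findex (next s) y x).
by rewrite permX; have [-> _] := iter_u (findex (next s) y x).
Qed.

Lemma mem_balanced_srange a b p : (p \in balanced (srange n a b)) = (a <= p.1.+1 <= b).
Proof.
have mem_s (i : 'I_n) (e : bool) : ((i, e) \in srange n a b) = ~~ e && (a <= i.+1 <= b).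
  apply/mapP/andP=> [[j] | [/negPf-> lei]].
    by rewrite mem_filter => /andP[lej _] [-> ->].
  by exists i; rewrite // mem_filter lei mem_enum.
case: p => i e; rewrite mem_cat mem_s -[(i, e)]snegK.
by rewrite (mem_map (inv_inj (@snegK n))) mem_s /=; case: e => /=; rewrite ?orbF.
Qed.

Lemma bcycle_Cn s : uniq (balanced s) -> bcycle s \in Cn n.
Proof.
move=> Us; apply/CnP=> p; rewrite !bcycleE //.
rewrite -(next_map (inv_inj (@snegK n)) Us).
have -> : [seq sneg q | q <- balanced s] = rot (size s) (balanced s).
  by rewrite /balanced rot_size_cat map_cat -map_comp (eq_map (@snegK n)) map_id.
by rewrite next_rot.
Qed.

Lemma gammaD_Cn : gammaD n \in Cn n.
Proof. by rewrite CnM ?bcycle_Cn ?uniq_balanced_srange. Qed.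

Lemma gammaD_orbit (c p q : spoint n) : c.1 = 0 :> nat ->
  (p \in porbit (gammaD n) q) = ((p.1 == c.1) == (q.1 == c.1)).
Proof.
move=> c0.
have val_c r : (r.1 == c.1) = (val r.1 == 0) by rewrite -val_eqE /= c0.
have mem1 r : (r \in balanced (srange n 1 1)) = (r.1 == c.1).
  by rewrite mem_balanced_srange val_c !ltnS leqn0.
have mem2 r : (r \in balanced (srange n 2 n)) = (r.1 != c.1).
  by rewrite mem_balanced_srange val_c ltnS lt0n ltn_ord andbT.
have U1 := uniq_balanced_srange n 1 1; have U2 := uniq_balanced_srange n 2 n.
have [qc | nqc] := boolP (q.1 == c.1).
  rewrite eqb_id -mem1; apply: porbit_next => //; last by rewrite mem1.
  move=> r sr; rewrite permM [bcycle (srange n 2 n) _]bcycleE // next_notin ?bcycleE //.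
  by rewrite mem2 negbK -mem1 mem_next.
rewrite eqbF_neg -mem2; apply: porbit_next => //; last by rewrite mem2.
move=> r; rewrite mem2 => nrc; rewrite permM.
rewrite [bcycle (srange n 1 1) _]bcycleE // next_notin ?mem1 //.
by rewrite bcycleE.
Qed.

(** Two orbits of even total length make gamma an even permutation. *)
Lemma gammaD_Dn : 2 <= n -> gammaD n \in Dn n.
Proof.
move=> n_ge2; rewrite mem_DnE gammaD_Cn /=.
pose c : spoint n := (Ordinal (ltnW n_ge2), false).
pose d : spoint n := (Ordinal n_ge2, false).
have orb p q := @gammaD_orbit c p q erefl.
have -> : odd_perm (gammaD n) = odd #|porbits (gammaD n)|.
  by rewrite /odd_perm card_prod card_bool muln2 odd_double.
have -> : porbits (gammaD n) = [set porbit (gammaD n) c; porbit (gammaD n) d].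
  apply/setP=> O; rewrite !inE; apply/imsetP/orP=> [[q _ ->]|]; last first.
    by case=> /eqP->; [exists c | exists d].
  by rewrite !eq_porbit_mem !orb; case: (q.1 == c.1); [left | right].
by rewrite cards2 eq_porbit_mem orb.
Qed.

End Gamma.

Theorem theorem4p14 (n : nat) (hn : 2 <= n) :
  is_lattice (dinterval (gammaD n)) (@dle n).
Proof.
apply: (two_orbit_interval_lattice (c := (Ordinal (ltnW hn), false))).
  exact: gammaD_Dn.
by move=> p q; apply: gammaD_orbit.
Qed.
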